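(* Let $n\ge1$ and let $(\rho_h^{n-1},m_h^{n-1})\in Q_h\times V_h$ with $\rho_h^{n-1}>0$. Then for $\tau>0$ sufficiently small (depending on the given data), the time-step system (D) stated in the context for determining $(\rho_h^n,m_h^n)\in Q_h\times V_h$ has a unique solution with $\rho_h^n>0$. If in addition $a\ge\underline a$ for some constant $\underline a>0$ (i.e. $a_e\ge\underline a$ for all $e\in\mathcal E$), then a solution (with $\rho_h^n>0$) exists for any choice of the time step $\tau>0$.
   Context: Network. $\mathcal G=(\mathcal V,\mathcal E,\ell)$ is a finite, directed, connected graph with vertex set $\mathcal V$, edge set $\mathcal E\subset\mathcal V\times\mathcal V$, and lengths $\ell_e>0$, $e\in\mathcal E$. An edge $e=(v_1,v_2)$ is identified with the interval $[0,\ell_e]$ ($v_1$ corresponding to $0$, $v_2$ to $\ell_e$), and $n_e(v_1)=-1$, $n_e(v_2)=1$. $\mathcal E(v)$ is the set of edges incident on $v$. For a function $u$ on the network, $u_e=u|_e$, and $u_e(v)$ is its value at the endpoint $v$. $L^2(\mathcal E)$ and $H^1(\mathcal E)$ are the spaces of functions with $u_e\in L^2(e)$, resp. $H^1(e)$, for every $e$ (no continuity at vertices); $(u,v)_{\mathcal E}=\sum_{e}\int_0^{\ell_e}u_ev_e\,dx$; $(\partial_x'u)|_e=\partial_x(u_e)$. $H_0(\mathrm{div})=\{m\in H^1(\mathcal E):\sum_{e\in\mathcal E(v)}m_e(v)n_e(v)=0\ \forall v\in\mathcal V\}$. Data. $a_e,b_e\ge0$, $c_e>0$ are constants on each edge,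 $a,b$ the edgewise constant functions with values $a_e,b_e$; $\gamma>1$; $P_e(\rho)=\frac{c_e}{\gamma-1}\rho^\gamma$; $P'(\rho)$ has restriction $P_e'(\rho_e)$ to $e$. Finite element spaces. $T_h(e)$ is a uniform mesh of $[0,\ell_e]$ into finitely many subintervals $K$, and $T_h(\mathcal E)$ is the collection of these meshes. $P_k(T_h(\mathcal E))$ is the space of functions in $L^2(\mathcal E)$ that are polynomials of degree $\le k$ on every element $K$. $V_h=P_1(T_h(\mathcal E))\cap H_0(\mathrm{div})$ and $Q_h=P_0(T_h(\mathcal E))$. Time-step system (D): with $\bar\partial_\tau d^n=\frac{d^n-d^{n-1}}{\tau}$, find $(\rho_h^n,m_h^n)\in Q_h\times V_h$ such that for all $q_h\in Q_h$ and $v_h\in V_h$ \begin{align*} (\bar\partial_\tau\rho_h^n,q_h)_{\mathcal E}&=-(\partial_x'm_h^n,q_h)_{\mathcal E},\\ \Big(\tfrac1{\rho_h^{n-1}}\bar\partial_\tau m_h^n-\tfrac{m_h^n}{2|\rho_h^n|^2}\bar\partial_\tau\rho_h^n,v_h\Big)_{\mathcal E}&=\Big(\tfrac{|m_h^n|^2}{2|\rho_h^n|^2}+P'(\rho_h^n)-\tfrac{a}{|\rho_h^n|^2}\partial_x'm_h^n,\partial_x'v_h\Big)_{\mathcal E}\\ &\quad-\Big(\tfrac{m_h^n}{2|\rho_h^n|^2}\partial_x'm_h^n,v_h\Big)_{\mathcal E}-\Big(b\tfrac{|m_h^n|m_h^n}{|\rho_h^n|^2},v_h\Big)_{\mathcal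 E}. \end{align*} *)

(* Defs.v *)
From HB Require Import structures.
From mathcomp Require Import all_boot all_order all_algebra.
From mathcomp Require Import all_classical all_reals all_analysis.
Set Implicit Arguments.
Unset Strict Implicit.
Unset Printing Implicit Defensive.
Import Order.TTheory GRing.Theory Num.Theory.
Import numFieldNormedType.Exports.
Local Open Scope classical_set_scope.
Local Open Scope ring_scope.

(* Connectedness is that of the underlying undirected graph. *)
Record network (R : realType) := Network {
  vertex : finType;
  edges : {set vertex * vertex};
  elen : {e : vertex * vertex | e \in edges} -> R;
  elen_gt0 : forall e, 0 < elen e;
  connected_network : forall u v : vertex,
    connect (fun x y => ((x, y) \in edges) || ((y, x) \in edges)) u v }.

Definition edge (R : realType) (G : network R) : finType :=
  {e : vertex G * vertex G | e \in edges G}.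

(* The length, as a function on [edge G] rather than on its unfolding. *)
Definition len (R : realType) (G : network R) (e : edge G) : R := elen e.

Section Spaces.
Context {R : realType} {G : network R}.
Local Notation mu := (@lebesgue_measure R).

(* A function on the network: u e is u_e, of which only the restriction to
   [0, len e] matters. *)
Definition netfun : Type := edge G -> R -> R.

Definition eint (e : edge G) : set R := `[0, len e].

(* Equality, resp. positivity, of elements of L^2(E): almost everywhere. *)
Definition net_eq (u v : netfun) : Prop :=
  forall e, u e = v e %[ae mu in eint e].

Definition net_pos (u : netfun) : Prop :=
  forall e, \forall x \ae mu, eint e x -> 0 < u e x.

Definition L2 (l : R) (f : R -> R) : Prop :=
  measurable_fun `[0, l] f /\
  mu.-integrable `[0, l] (fun x => (f x ^+ 2)%:E).

(* H^1(0, l): primitives of square-integrable functions. Elements of H^1 are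
   thus given by their absolutely continuous representative, so that endpoint
   values are meaningful, and the weak derivative is almost everywhere the
   classical one. *)
Definition H1 (l : R) (f : R -> R) : Prop :=
  exists2 g, L2 l g &
    forall x, x \in `[0, l] -> f x = f 0 + \int[mu]_(t in `[0, x]) g t.

Definition L2net (u : netfun) : Prop := forall e, L2 (len e) (u e).

Definition H1net (u : netfun) : Prop := forall e, H1 (len e) (u e).

Definition ip (u v : netfun) : R :=
  \sum_(e : edge G) \int[mu]_(x in eint e) (u e x * v e x).

Definition dx (u : netfun) : netfun := fun e => derive1 (u e).

(* \sum_(e in E(v)) m_e(v) n_e(v), with n_e = 1 at the head of e and n_e = -1
   at its tail; both ends of a loop contribute. *)
Definition netflux (m : netfun) (v : vertex G) : R :=
  \sum_(e : edge G | (val e).2 == v) m e (len e) * 1 +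
  \sum_(e : edge G | (val e).1 == v) m e 0 * (-1).

Definition H0div (m : netfun) : Prop :=
  H1net m /\ forall v, netflux m v = 0.

(* N e is the number of elements of the uniform mesh of e. *)
Definition node (N : edge G -> nat) (e : edge G) (i : nat) : R :=
  i%:R * len e / (N e)%:R.

Definition element (N : edge G -> nat) (e : edge G) (i : nat) : set R :=
  `[node N e i, node N e i.+1].

(* Degree <= k is size <= k.+1. *)
Definition Pk (N : edge G -> nat) (k : nat) (u : netfun) : Prop :=
  L2net u /\
  forall e (i : 'I_(N e)), exists2 p : {poly R}, (size p <= k.+1)%N &
    u e = horner p %[ae mu in element N e i].

Definition Vh (N : edge G -> nat) (m : netfun) : Prop :=
  Pk N 1 m /\ H0div m.

Definition Qh (N : edge G -> nat) (rho : netfun) : Prop := Pk N 0 rho.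

Definition pot (c : edge G -> R) (gamma : R) (e : edge G) (r : R) : R :=
  c e / (gamma - 1) * r `^ gamma.

Definition dpot (c : edge G -> R) (gamma : R) (rho : netfun) : netfun :=
  fun e x => derive1 (pot c gamma e) (rho e x).

Definition bdiff (tau : R) (d d0 : netfun) : netfun :=
  fun e x => (d e x - d0 e x) / tau.

(* One time step, from (rho0, m0) at level n-1 to (rho, m) at level n. *)
Definition time_step (N : edge G -> nat) (a b c : edge G -> R) (gamma tau : R)
    (rho0 m0 rho m : netfun) : Prop :=
  [/\ Qh N rho, Vh N m,
   forall q, Qh N q -> ip (bdiff tau rho rho0) q = - ip (dx m) q &
   forall v, Vh N v ->
     ip (fun e x => 1 / rho0 e x * bdiff tau m m0 e x
           - m e x / (2 * `|rho e x| ^+ 2) * bdiff tau rho rho0 e x) v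
     = ip (fun e x => `|m e x| ^+ 2 / (2 * `|rho e x| ^+ 2)
             + dpot c gamma rho e x
             - a e / `|rho e x| ^+ 2 * dx m e x) (dx v)
       - ip (fun e x => m e x / (2 * `|rho e x| ^+ 2) * dx m e x) v
       - ip (fun e x => b e * (`|m e x| * m e x / `|rho e x| ^+ 2)) v].

End Spaces.

Arguments netfun {R} G.

(* Main.v *)
(* The mass balance gives the density as an explicit affine function of the
   momentum, so that one step is a nonlinear system for the nodal values of the
   momentum on the space cut out by the flux conditions. Tested with its own
   solution, this system gives an energy bound for the momentum that does not
   depend on the time step; for small time steps it keeps the density away from
   zero, and uniqueness follows since the nonlinear terms are Lipschitz while
   the inertial term carries the factor 1/tau. If a is positive, the dissipation
   a |m'|^2 / rho^2 keeps the density positive for every time step. Existence is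
   obtained after truncating the density from below: a continuous vector field
   pointing outwards far from the origin has a zero. This form of Brouwer's
   theorem is proved by a parity argument on Kuhn's triangulation of a discrete
   torus, on which every labelling has an even number of fully labelled
   simplices; those that cross the seam are the same as for a reference
   labelling, which has exactly one fully labelled simplex off the seam. *)
Require Import Defs.
From mathcomp Require Import all_boot all_order all_algebra all_fingroup.
From mathcomp Require Import zify ring lra.
From mathcomp Require boolp.
Set Implicit Arguments.
Unset Strict Implicit.
Unset Printing Implicit Defensive.
Import Order.TTheory GRing.Theory Num.Theory.
Local Open Scope ring_scope.

(** * Kuhn's triangulation of a discrete torus *)

(** The obstacle is the transport term: tested with the solution it becomes a multiple of s m^2 /
    rho^2, with s the slope of m, which is cubic and has no sign. The mass balance decides. If s > 0
    the term has the good sign. If s <= 0, then s = (rho0 - rho) / tau with rho0 the old density,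
    and an eighth of the inertial term completes it to m^2 times the square (rho - 2 rho0)^2 / (8
    tau rho0 rho^2), whatever the time step. The pressure is harmful only where s > 0; there rho <=
    rho0, and the pressure is at most its old value. The exact relation between rho and s thus
    enters only where s <= 0, and there the density is at least rho0. A truncation at or below rho0
    / 2 is inactive at such places, so the estimates survive it. Each existence proof ends by
    showing that the truncation is inactive everywhere at the solution found. *)

Lemma involution_even_card (T : finType) (A : {set T}) (f : T -> T) :
  (forall x, x \in A -> [/\ f x \in A, f (f x) = x & f x != x]) -> ~~ odd #|A|.
Proof.
have [n] := ubnP #|A|; elim: n A => // n IH A leA fA.
have [->|[x xA]] := set_0Vmem A; first by rewrite cards0.
have [fxA ffx fxx] := fA x xA.
have fxA' : f x \in A :\ x by rewrite !inE fxx fxA.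
rewrite (cardsD1 x) xA (cardsD1 (f x)) fxA' /= negbK.
apply: IH => [|y].
  by move: leA; rewrite (cardsD1 x) xA (cardsD1 (f x)) fxA' /=; lia.
rewrite !inE => /and3P[yfx yx yA]; have [fyA ffy fyy] := fA y yA.
split=> //; rewrite fyA andbT; apply/andP; split.
  by apply: contra yx => /eqP e; rewrite -ffy e ffx.
by apply: contra yfx => /eqP e; rewrite -e ffy.
Qed.

Section Torus.
Variables (A : finZmodType) (n : nat) (e : 'I_n.+2 -> A).
Hypothesis sum_e : \sum_i e i = 0.
Variable lab : A -> 'I_n.+2.

Local Notation flag := (A * {perm 'I_n.+2})%type.

(* The flag (v, s) stands for the closed path v, v + e (s 0), v + e (s 0) +
   e (s 1), ... ; its vertices span a simplex of Kuhn's triangulation, and the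
   rotations of a flag have the same vertices. *)
Definition flag_vertex (s : flag) (t : nat) : A :=
  s.1 + \sum_(j < t) e (s.2 (inZp j)).

Definition rotate_flag (k : nat) (s : flag) : flag :=
  (flag_vertex s k, perm (addIr (inZp k : 'I_n.+2)) * s.2)%g.

Lemma flag_vertex_rotate k s t :
  flag_vertex (rotate_flag k s) t = flag_vertex s (k + t).
Proof.
rewrite /flag_vertex /= -addrA; congr (_ + _).
rewrite big_split_ord /=; congr (_ + _); apply: eq_bigr => j _.
rewrite permM permE; congr (e (s.2 _)).
by apply: val_inj => /=; rewrite modnDml modnDmr addnC.
Qed.

(** Any [n.+2] consecutive steps use every [e i] exactly once. *)
Lemma flag_vertex_period s t : flag_vertex s (t + n.+2) = flag_vertex s t.
Proof.
rewrite /flag_vertex big_split_ord /= addrA -[RHS]addr0; congr (_ + _).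
pose u := (perm (addIr (inZp t : 'I_n.+2)) * s.2)%g.
rewrite -[RHS]sum_e [RHS](reindex_inj (@perm_inj _ u)) /=; apply: eq_bigr => j _.
rewrite permM permE; congr (e (s.2 _)).
by apply: val_inj => /=; rewrite modnDmr addnC.
Qed.

Lemma flag_vertex_mod s t : flag_vertex s (t %% n.+2)%N = flag_vertex s t.
Proof.
rewrite {2}(divn_eq t n.+2); elim: (t %/ n.+2)%N => [|q IH].
  by rewrite mul0n add0n.
by rewrite mulSn -addnA addnC flag_vertex_period.
Qed.

Lemma rotate_flag_comp k l s :
  rotate_flag k (rotate_flag l s) = rotate_flag (l + k) s.
Proof.
rewrite /rotate_flag flag_vertex_rotate; congr pair; apply/permP => i /=.
rewrite !permM !permE; congr (s.2 _); apply: val_inj => /=.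
by rewrite !modnDml !modnDmr addnAC modnDmr addnA.
Qed.

Lemma rotate_flag_period s : rotate_flag n.+2 s = s.
Proof.
have vE : flag_vertex s n.+2 = s.1.
  by have := flag_vertex_period s 0; rewrite add0n => ->; rewrite /flag_vertex big_ord0 addr0.
rewrite /rotate_flag vE; case: s {vE} => v s; congr pair.
apply/permP => i /=; rewrite permM permE; congr (s _).
by apply: val_inj => /=; rewrite modnn addn0 modn_small.
Qed.

Definition flag_label (s : flag) (i : 'I_n.+2) : 'I_n.+2 := lab (flag_vertex s i).

(** Fixing the label of the last vertex selects one of the rotations of a flag, so that a closed
    path is counted once. *)
Definition full_flag (s : flag) : bool :=
  injectiveb (flag_label s) && (flag_label s ord_max == ord_max).

(* The facet opposite to the last vertex carries every label but the last. *)
Definition door (s : flag) : bool :=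
  [set flag_label s i | i in [set~ ord_max]] == [set~ ord_max].

Lemma door_inj s : door s -> {in [set~ ord_max] &, injective (flag_label s)}.
Proof. by move=> /eqP ds; apply/imset_injP; rewrite ds. Qed.

Lemma door_full s : full_flag s = door s && (flag_label s ord_max == ord_max).
Proof.
rewrite /full_flag; case: eqP; rewrite ?andbF // => lm; rewrite !andbT.
apply/injectiveP/idP => [inj|ds].
  rewrite /door eqEcard card_imset // leqnn andbT.
  apply/subsetP => _ /imsetP[i + ->]; rewrite !inE.
  by apply: contra => /eqP lim; rewrite (inj i ord_max) ?lim ?lm.
have notmax i : i != ord_max -> flag_label s i != ord_max.
  move=> im; suff: flag_label s i \in [set~ ord_max] by rewrite !inE.
  by rewrite -(eqP ds) imset_f // !inE.
move=> i j; case: (eqVneq i ord_max) => [->|im]; case: (eqVneq j ord_max) => [->|jm] //.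
- by rewrite lm => h; have := notmax j jm; rewrite -h eqxx.
- by rewrite lm => h; have := notmax i im; rewrite h eqxx.
- by apply: (door_inj ds); rewrite !inE.
Qed.

(* Exchanging the last two steps of a flag moves its last vertex only. *)
Lemma door_even : ~~ odd #|[set s | door s]|.
Proof.
pose a : 'I_n.+2 := inord n.
have va : val a = n by rewrite /= inordK.
have am : a != ord_max by rewrite -val_eqE /= inordK // neq_ltn ltnSn.
pose f (s : flag) : flag := (s.1, tperm a ord_max * s.2)%g.
have fV s (i : 'I_n.+2) : i != ord_max -> flag_vertex (f s) i = flag_vertex s i.
  rewrite -val_eqE /= => im; congr (_ + _); apply: eq_bigr => j _.
  rewrite permM tpermD //; rewrite -val_eqE /= ?va modn_small ?neq_ltn //;
    have := ltn_ord j; have := ltn_ord i; lia.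
apply: (@involution_even_card _ _ f) => s; rewrite inE => ds; split.
- rewrite inE /door -[X in _ == X](eqP ds); apply/eqP.
  apply: eq_in_imset => i; rewrite !inE => im.
  by rewrite /flag_label fV.
- by case: s {ds} => v s; rewrite /f /= mulgA tperm2 mul1g.
- apply/eqP => /(congr1 snd) /= /(congr1 (fun p : {perm _} => p a)).
  by rewrite permM tpermL => /perm_inj/esym/eqP; rewrite (negbTE am).
Qed.

(* In a door that is not full, exactly one other vertex has the label of the
   last one; rotating it into the last position is an involution. *)
Lemma full_flag_even : ~~ odd #|[set s | full_flag s]|.
Proof.
have -> : [set s | full_flag s] =
    [set s | door s] :\: [set s | door s && (flag_label s ord_max != ord_max)].
  by apply/setP => s; rewrite !inE door_full; case: door; rewrite //= negbK andbT.
rewrite cardsD oddB ?subset_leq_card ?subsetIl //.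
have /setIidPr -> : [set s | door s && (flag_label s ord_max != ord_max)]
    \subset [set s | door s].
  by apply/subsetP => s; rewrite !inE => /andP[].
rewrite (negbTE door_even) /=.
pose dup s i := (i != ord_max) && (flag_label s i == flag_label s ord_max).
pose f s := rotate_flag (odflt ord0 [pick i | dup s i]).+1 s.
apply: (@involution_even_card _ _ f) => s; rewrite inE => /andP[ds lm].
have /imsetP[i] : flag_label s ord_max \in [set flag_label s i | i in [set~ ord_max]].
  by rewrite (eqP ds) !inE.
rewrite !inE => im /esym li.
have dupi u j : door u -> dup u j -> [pick i | dup u i] = Some j.
  move=> du /andP[jm /eqP lj]; case: pickP => [k /andP[km /eqP lk]|/(_ j)].
    by congr Some; apply: (door_inj du); rewrite ?inE // lk.
  by rewrite /dup jm lj eqxx.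
have fE : f s = rotate_flag i.+1 s.
  by rewrite /f (dupi s i) // /dup im li eqxx.
have labf j : flag_label (rotate_flag i.+1 s) j = flag_label s (inZp (i.+1 + j)).
  by rewrite /flag_label flag_vertex_rotate /= flag_vertex_mod.
have lmax : flag_label (rotate_flag i.+1 s) ord_max = flag_label s ord_max.
  rewrite labf -li; congr (flag_label s _); apply: val_inj => /=.
  by rewrite addSnnS modnDr modn_small.
have iS : (i < n.+1)%N.
  by move: im; rewrite -val_eqE /= neq_ltn; have := ltn_ord i; lia.
(* Rotation by [i.+1] brings vertex [i] into the last position and the old last vertex to position
   [n - i]. Rotating back takes [n - i + 1] further steps, in all the period [n.+2]. *)
pose j : 'I_n.+2 := inord (n - i).
have vj : val j = (n - i)%N by rewrite /= inordK //; lia.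
have jm : j != ord_max by rewrite -val_eqE vj /=; lia.
have lj : flag_label (rotate_flag i.+1 s) j = flag_label s ord_max.
  rewrite labf; congr (flag_label s _); apply: val_inj => /=.
  rewrite vj (_ : i.+1 + (n - i) = n.+1)%N ?modn_small //; lia.
have df : door (rotate_flag i.+1 s).
  rewrite /door -[X in _ == X](eqP ds) eqEsubset; apply/andP; split; apply/subsetP => p /imsetP[k];
    rewrite !inE => km ->.
  - rewrite labf; case: (eqVneq (inZp (i.+1 + k) : 'I_n.+2) ord_max) => [->|km'].
      by rewrite -li; apply: imset_f; rewrite !inE.
    by apply: imset_f; rewrite !inE.
  - case: (eqVneq k i) => [->|ki].
      by rewrite li -lj; apply: imset_f; rewrite !inE.
    pose k' : 'I_n.+2 := inZp (k + (n.+2 - i.+1)).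
    have -> : k = inZp (i.+1 + k').
      apply: val_inj => /=; rewrite modnDmr addnCA.
      rewrite subnKC ?modnDr ?modn_small //; lia.
    rewrite -labf; apply: imset_f; rewrite !inE; apply: contra ki => /eqP/(congr1 val) /= k'm.
    have : ((k + (n.+2 - i.+1) + i.+1) %% n.+2 = (n.+1 + i.+1) %% n.+2)%N.
      by rewrite -modnDml k'm.
    rewrite -addnA subnK; last by lia.
    by rewrite modnDr -addSnnS modnDl !modn_small // => /ord_inj ->.
rewrite fE; split.
- by rewrite df lmax lm.
- rewrite {1}/f (dupi _ j) //; last by rewrite /dup jm lj lmax eqxx.
  rewrite rotate_flag_comp vj /= (_ : i.+1 + (n - i).+1 = n.+2)%N ?rotate_flag_period //; lia.
- apply/eqP => /(congr1 snd) /= /(congr1 (fun p : {perm _} => p ord0)).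
  rewrite permM permE => /perm_inj/(congr1 val) /=.
  rewrite add0n modn_mod modn_small //; lia.
Qed.

End Torus.

(** Both sides have the same sum over [i], so every inequality is an equality. *)
Lemma perm_ge_id (n : nat) (s : {perm 'I_n}) :
  (forall i : 'I_n, i <= s i)%N -> s = 1%g.
Proof.
move=> les; apply/permP => i; rewrite perm1.
have := leqif_sum (fun (j : 'I_n) (_ : true) => leqif_eq (les j)).
case=> _.
rewrite [X in X == _](reindex_inj (@perm_inj _ s)) eqxx.
by move/esym/forallP => /(_ i) /eqP h; apply: ord_inj.
Qed.

(** * Canonical labelling and fully labelled simplices off the seam *)

Section Grid.
Variables (n k h : nat).
Hypotheses (h_gt1 : (1 < h)%N) (h_lek : (h <= k)%N).
Local Notation A := 'rV['I_k.+1]_n.+1.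


(** Unit steps in the coordinate directions and, as direction [ord_max], the way back along the main
    diagonal. Coordinates live in the cyclic group of order [k.+1]. *)
Definition grid_step (d : 'I_n.+2) : A :=
  \row_c (if d == ord_max then - inZp 1 else if d == c :> nat then inZp 1 else 0).

Lemma sum_grid_step : \sum_d grid_step d = 0.
Proof.
apply/rowP => c; rewrite summxE mxE.
rewrite (bigD1 ord_max) //= (bigD1 (widen_ord (leqnSn _) c)); last first.
  by rewrite -val_eqE /= neq_ltn ltn_ord.
rewrite big1 /= ?addr0 => [|d /andP[dm dc]]; rewrite !mxE /= ?(negbTE dm).
  have -> : (widen_ord (leqnSn n.+1) c == ord_max) = false.
    by apply/negbTE; rewrite -val_eqE /= neq_ltn ltn_ord.
  by rewrite !eqxx addNr.
by case: eqP => // e; case/eqP: dc; apply: val_inj.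
Qed.

Let flag := (A * {perm 'I_n.+2})%type.
Let V (s : flag) (i : nat) : A := flag_vertex grid_step s i.
Let position (s : flag) (d : 'I_n.+2) : nat := (s.2^-1)%g d.
Let dir (c : 'I_n.+1) : 'I_n.+2 := widen_ord (leqnSn _) c.

Lemma dir_neq c : (dir c == ord_max) = false.
Proof. by apply/negbTE; rewrite -val_eqE /= neq_ltn ltn_ord. Qed.

Lemma position_inj s : injective (position s).
Proof. by move=> d d' /ord_inj/perm_inj. Qed.

Lemma position_lt s d : (position s d < n.+2)%N.
Proof. exact: ltn_ord. Qed.

(** A coordinate rises at its own step and falls at the diagonal one; the booleans tell whether
    these steps have been taken. *)
Lemma flag_vertex_coord s c (i : nat) : (i <= n.+2)%N ->
  V s i 0 c = s.1 0 c + inZp (position s (dir c) < i)%N - inZp (position s ord_max < i)%N.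
Proof.
rewrite /V /flag_vertex mxE summxE -!addrA => le_i; congr (_ + _).
elim: i le_i => [|i IH] le_i; first by rewrite big_ord0 /= subrr.
rewrite big_ord_recr /= IH ?(ltnW le_i) // mxE.
have posE d : (s.2 (inZp i) == d) = (position s d == i).
  rewrite /position -[d in LHS](permKV s.2) (inj_eq perm_inj) -val_eqE /=.
  by rewrite modn_small // eq_sym.
have ltE d : (position s d < i.+1)%N = (position s d < i)%N || (position s d == i).
  by rewrite ltnS leq_eqVlt orbC.
have dirE : (s.2 (inZp i) == c :> nat) = (position s (dir c) == i).
  by rewrite -posE -val_eqE.
have inZp0 : inZp 0 = 0 :> 'I_k.+1 by apply: val_inj => /=; rewrite mod0n.
rewrite dirE posE !ltE.
have [pm|pm] := eqVneq (position s ord_max) i.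
  have /negbTE -> : position s (dir c) != i.
    by rewrite -pm (inj_eq (@position_inj s)) dir_neq.
  by rewrite pm ltnn /= !orbF inZp0 subr0.
have [pc|pc] := eqVneq (position s (dir c)) i; rewrite /= !(orbT, orbF).
  by rewrite pc ltnn /= inZp0 add0r addrC.
by rewrite addr0.
Qed.

(** Along a flag each coordinate takes two cyclically consecutive values, so the condition says that
    some coordinate wraps around from [k] to 0. All vertices then lie on faces of the cube where
    [grid_labelling] prescribes the labels. *)
Definition seam (s : flag) : bool :=
  [exists c, [forall i : 'I_n.+2, (V s i 0 c == 0 :> nat) || (V s i 0 c == k :> nat)]].

(** Off the seam nothing wraps around, and a coordinate takes the values [a] and [a + 1] as natural
    numbers. If its own step precedes the diagonal one, the path starts at the lower value,
    otherwise at the upper one. *)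
Lemma nonseam_coord s c : ~~ seam s ->
  exists2 a, (a < k)%N & forall i : 'I_n.+2,
   V s i 0 c = (a + (if (position s (dir c) < position s ord_max)%N
     then (position s (dir c) < i <= position s ord_max)%N
     else ~~ (position s ord_max < i <= position s (dir c))%N))%N :> nat.
Proof.
rewrite negb_exists => /forallP/(_ c); rewrite negb_forall => /existsP[i0].
set pc := position s (dir c); set pm := position s ord_max.
have VE (i : 'I_n.+2) := flag_vertex_coord s c (ltnW (ltn_ord i)).
have valD (x : 'I_k.+1) (b b' : bool) : (x + inZp b - inZp b' : 'I_k.+1) =
    (if b && ~~ b' then (if x == k :> nat then 0 else x.+1)
     else if b' && ~~ b then (if x == 0 :> nat then k else x.-1) else x)%N :> nat.
  have inZp0 : inZp 0 = 0 :> 'I_k.+1 by apply: val_inj => /=; rewrite mod0n.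
  have k1 : (1 %% k.+1 = 1)%N by rewrite modn_small //; lia.
  have D1 : (x + inZp 1 : 'I_k.+1) = (if x == k :> nat then 0 else x.+1)%N :> nat.
    rewrite /= modnDmr; case: eqP => [->|xk]; first by rewrite addn1 modnn.
    by rewrite addn1 modn_small //; have := ltn_ord x; lia.
  have B1 : (x - inZp 1 : 'I_k.+1) = (if x == 0 :> nat then k else x.-1)%N :> nat.
    rewrite /= modnDmr k1; case: eqP => [->|xk].
      by rewrite add0n subSS subn0 modn_small.
    rewrite subSS subn0 (_ : x + k = x.-1 + k.+1)%N; last lia.
    rewrite modnDr modn_small //; have := ltn_ord x; lia.
  case: b b' => [] [].
  - by rewrite addrK.
  - by rewrite inZp0 subr0 D1.
  - by rewrite inZp0 addr0 B1.
  - by rewrite inZp0 addr0 subr0.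
pose x := s.1 0 c.
have pcm : pc != pm by rewrite (inj_eq (@position_inj s)) dir_neq.
have xlt : (x < k.+1)%N := ltn_ord x.
have := VE i0; move/(congr1 val) => /=; rewrite [X in _ = X -> _]valD -/pc -/pm -/x => V0.
case: (ltnP pc pm) => lt; rewrite V0.
  move=> H; exists x => [|i].
    move: H; case: (ltnP pc i0); case: (ltnP pm i0) => /=;
      case: (eqVneq (x : nat) k); case: (eqVneq (x : nat) 0) => /=; lia.
  rewrite VE valD -/pc -/pm -/x.
  have xk : (x == k :> nat) = false.
    by move: H; case: (ltnP pc i0); case: (ltnP pm i0) => /=;
      case: (eqVneq (x : nat) k); case: (eqVneq (x : nat) 0) => /=; lia.
  rewrite xk; case: (ltnP pc i); case: (ltnP pm i) => /=; lia.
move=> H; exists x.-1 => [|i].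
  move: H; case: (ltnP pc i0); case: (ltnP pm i0) => /=;
      case: (eqVneq (x : nat) k); case: (eqVneq (x : nat) 0) => /=; lia.
rewrite VE valD -/pc -/pm -/x.
have x0 : (x == 0 :> nat) = false.
  by move: H; case: (ltnP pc i0); case: (ltnP pm i0) => /=;
      case: (eqVneq (x : nat) k); case: (eqVneq (x : nat) 0) => /=; lia.
rewrite x0; case: (ltnP pc i); case: (ltnP pm i) => /=; lia.
Qed.

(** A Sperner label: [find] returns the length of the list when no test fails, which is the label
    [ord_max]. *)
Definition first_failure (b : 'I_n.+1 -> bool) : 'I_n.+2 :=
  inord (find (fun c => ~~ b c) (enum 'I_n.+1)).

Lemma first_failure_max b : (first_failure b == ord_max) = [forall c, b c].
Proof.
have fle : (find (fun c => ~~ b c) (enum 'I_n.+1) <= n.+1)%N.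
  by rewrite -[X in (_ <= X)%N](size_enum_ord n.+1) find_size.
rewrite -val_eqE /= inordK // eqn_leq fle /=.
rewrite -[X in (X <= _)%N](size_enum_ord n.+1) leqNgt -has_find.
apply/hasPn/forallP => [bT c|bT c _]; last by rewrite negbK.
by have := bT c (mem_enum _ c); rewrite negbK.
Qed.

Lemma first_failureP b c : first_failure b = dir c ->
  ~~ b c /\ forall c' : 'I_n.+1, (c' < c)%N -> b c'.
Proof.
have fle : (find (fun c => ~~ b c) (enum 'I_n.+1) <= n.+1)%N.
  by rewrite -[X in (_ <= X)%N](size_enum_ord n.+1) find_size.
move=> /(congr1 val) /=; rewrite inordK // => fc.
split=> [|c' lt].
  have : has (fun c => ~~ b c) (enum 'I_n.+1) by rewrite has_find fc size_enum_ord.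
  by move=> /(nth_find c); rewrite fc nth_ord_enum.
have := @before_find _ c (fun c => ~~ b c) (enum 'I_n.+1) c'.
by rewrite fc lt nth_ord_enum => /(_ isT)/negbFE.
Qed.

Lemma first_failure_le b c : ~~ b c -> (first_failure b <= c)%N.
Proof.
move=> nbc; rewrite leqNgt; apply/negP.
have fle : (find (fun c => ~~ b c) (enum 'I_n.+1) <= n.+1)%N.
  by rewrite -[X in (_ <= X)%N](size_enum_ord n.+1) find_size.
rewrite /= inordK // => lt.
have := @before_find _ c (fun c => ~~ b c) (enum 'I_n.+1) c lt.
by rewrite nth_ord_enum nbc.
Qed.

Let canonical_label (x : A) : 'I_n.+2 := first_failure (fun c => (h <= x 0%R c)%N).

(** In a full flag the last vertex has all coordinates at least [h], while each label [c] forces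
    some vertex with coordinate [c] below [h]; hence every coordinate passes from [h - 1] to [h].
    Labels then do not decrease along the path, so vertex [i] has label [i], and the directions come
    in their natural order. *)
Lemma canonical_full_flag s :
  ~~ seam s && full_flag grid_step canonical_label s =
  (s == (const_mx (inZp h.-1), 1%g)).
Proof.
apply/andP/eqP => [[ns /andP[/injectiveP inj]]|->].
  rewrite first_failure_max => /forallP hmax.
  have surj d : exists i : 'I_n.+2, flag_label grid_step canonical_label s i = d.
    by have [g _ gK] := injF_bij inj; exists (g d).
  have low c : exists i : 'I_n.+2, (V s i 0%R c < h)%N.
    have [i /first_failureP[Hc _]] := surj (dir c).
    by exists i; rewrite ltnNge.
  (* If a coordinate direction came last, the last vertex would have the lower of its two values in
     that coordinate, yet at least [h], against [low]. *)
  have pmE : position s ord_max = n.+1.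
    have [d dE] : exists d, position s d = n.+1.
      by exists (s.2 ord_max); rewrite /position permK.
    have [<- //|dm] := eqVneq d ord_max.
    have dlt : (d < n.+1)%N by move: dm; rewrite -val_eqE /=; have := ltn_ord d; lia.
    have ed : d = dir (Ordinal dlt) by apply: val_inj.
    have [a ak aE] := nonseam_coord (Ordinal dlt) ns.
    have [i] := low (Ordinal dlt).
    have := hmax (Ordinal dlt); rewrite -[flag_vertex _ _ _]/(V s ord_max) !aE -ed dE.
    have := position_lt s ord_max; have := ltn_ord i; rewrite /=.
    by do ![case: ifP]; lia.
  have coord c : (s.1 0 c = h.-1 :> nat) /\
      forall i : 'I_n.+2, V s i 0 c = (h.-1 + (position s (dir c) < i))%N :> nat.
    have [a ak aE] := nonseam_coord c ns.
    have lt : (position s (dir c) < n.+1)%N.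
      have := position_lt s (dir c); rewrite ltnS leq_eqVlt => /orP[/eqP|//].
      by rewrite -pmE => /position_inj/eqP; rewrite dir_neq.
    have [i] := low c; have := hmax c.
    rewrite -[flag_vertex _ _ _]/(V s ord_max) !aE pmE lt => am ai.
    have aE' : a = h.-1 by move: am ai => /=; have := ltn_ord i; lia.
    have := aE ord0; rewrite pmE lt /= /V /flag_vertex big_ord0 addr0 => ->; split; first by lia.
    by move=> j; rewrite aE pmE lt aE'; have := ltn_ord j; lia.
  have labE c i : flag_label grid_step canonical_label s i = dir c ->
      (i <= position s (dir c))%N.
    move=> /first_failureP[]; rewrite -[flag_vertex _ _ _]/(V s i).
    by have [_ ->] := coord c; lia.
  have mono (i j : 'I_n.+2) : (i <= j)%N ->
     (flag_label grid_step canonical_label s i <= flag_label grid_step canonical_label s j)%N.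
    move=> le_ij; have [->|lm] := eqVneq (flag_label grid_step canonical_label s j) ord_max.
      by rewrite -ltnS ltn_ord.
    have lt : (flag_label grid_step canonical_label s j < n.+1)%N.
      by move: lm; rewrite -val_eqE /=; have := ltn_ord (flag_label grid_step canonical_label s j); lia.
    have ed : flag_label grid_step canonical_label s j = dir (Ordinal lt) by apply: val_inj.
    have jc := labE _ _ ed; rewrite [X in (_ <= X)%N](congr1 val ed) /=.
    apply: (@first_failure_le (fun c => (h <= V s i 0%R c)%N) (Ordinal lt)).
    by have [_ ->] := coord (Ordinal lt); move: jc => /=; lia.
  have idl i : flag_label grid_step canonical_label s i = i.
    have ge (m : nat) (j : 'I_n.+2) : m = j ->
        (m <= flag_label grid_step canonical_label s j)%N.
      elim: m j => // m IH j mj.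
      have mlt : (m < n.+2)%N by have := ltn_ord j; lia.
      apply: (leq_ltn_trans (IH (Ordinal mlt) erefl)).
      rewrite ltn_neqAle mono /= ?andbT; last by lia.
      by apply/negP => /eqP/ord_inj/inj/(congr1 val) /=; lia.
    have := @perm_ge_id _ (perm inj) _.
    by move=> /(_ (fun j => _)) pid; rewrite -[LHS](permE inj) pid ?perm1 // => j; rewrite permE ge.
  have s2 : s.2 = 1%g.
    apply/eqP; rewrite -invg_eq1; apply/eqP/perm_ge_id => d.
    have [->|dm] := eqVneq d ord_max; first by rewrite [X in (_ <= X)%N]pmE.
    have dlt : (d < n.+1)%N by move: dm; rewrite -val_eqE /=; have := ltn_ord d; lia.
    have ed : d = dir (Ordinal dlt) by apply: val_inj.
    by have := @labE (Ordinal dlt) d; rewrite -ed; apply.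
  rewrite [s]surjective_pairing s2; congr pair.
  apply/rowP => c; rewrite mxE; apply: val_inj => /=.
  have [-> _] := coord c; rewrite modn_small //; lia.
set t : flag := (_, _).
have posE d : position t d = d by rewrite /position /= invg1 perm1.
have coord c (i : 'I_n.+2) : V t i 0 c = (h.-1 + (c < i))%N :> nat.
  rewrite flag_vertex_coord ?(ltnW (ltn_ord i)) // !posE mxE.
  have -> : (val (@ord_max n.+1) < i)%N = false by have := ltn_ord i; rewrite /=; lia.
  have -> : inZp 0 = 0 :> 'I_k.+1 by apply: val_inj => /=; rewrite mod0n.
  rewrite subr0 /= !modnDml modnDmr modn_small //; lia.
have labE i : flag_label grid_step canonical_label t i = i.
  have [->|im] := eqVneq i ord_max.
    apply/eqP; rewrite first_failure_max; apply/forallP => c.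
    rewrite -[flag_vertex _ _ _]/(V t ord_max) coord /=; have := ltn_ord c; lia.
  have lt : (i < n.+1)%N by move: im; rewrite -val_eqE /=; have := ltn_ord i; lia.
  have le : (flag_label grid_step canonical_label t i <= i)%N.
    apply: (@first_failure_le (fun c => (h <= V t i 0%R c)%N) (Ordinal lt)).
    rewrite coord /=; lia.
  apply/ord_inj/eqP; rewrite eqn_leq le /= leqNgt; apply/negP => lt'.
  have lt2 : (flag_label grid_step canonical_label t i < n.+1)%N by lia.
  have ed : flag_label grid_step canonical_label t i = dir (Ordinal lt2) by apply: val_inj.
  have [+ _] := first_failureP ed.
  rewrite -[flag_vertex _ _ _]/(V t i) coord /=; lia.
split.
  rewrite negb_exists; apply/forallP => c; rewrite negb_forall; apply/existsP; exists ord0.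
  rewrite coord /=; lia.
apply/andP; split; last by rewrite labE.
by apply/injectiveP => i j; rewrite !labE.
Qed.

(* Off the seam every labelling has as many fully labelled simplices as the
   canonical one, modulo 2. *)
Lemma grid_labelling (g : A -> 'I_n.+1 -> bool) :
  (forall (x : A) c, (x 0 c == 0 :> nat) || (x 0 c == k :> nat) ->
     forall d, g x d = (h <= x 0%R d)%N) ->
  exists (x : A) (y : 'I_n.+1 -> A), [/\ forall c, g x c, forall c, ~~ g (y c) c &
    forall c d, (y c 0%R d <= (x 0%R d).+1)%N /\ (x 0%R d <= (y c 0%R d).+1)%N].
Proof.
move=> gP; pose lab x := first_failure (g x).
have parity (l : A -> 'I_n.+2) := full_flag_even sum_grid_step l.
have splitE (l : A -> 'I_n.+2) : odd #|[set s | ~~ seam s && full_flag grid_step l s]| =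
    odd #|[set s | seam s && full_flag grid_step l s]|.
  have := parity l; rewrite -(cardsID [set s | seam s] [set s | full_flag grid_step l s]) oddD.
  rewrite (_ : _ :&: _ = [set s | seam s && full_flag grid_step l s]); last first.
    by apply/setP => s; rewrite !inE andbC.
  rewrite (_ : _ :\: _ = [set s | ~~ seam s && full_flag grid_step l s]); last first.
    by apply/setP => s; rewrite !inE.
  by case: odd; case: odd.
have : odd #|[set s | ~~ seam s && full_flag grid_step lab s]|.
  rewrite splitE.
  have -> : [set s | seam s && full_flag grid_step lab s] =
      [set s | seam s && full_flag grid_step canonical_label s].
    apply/setP => s; rewrite !inE; case: (boolP (seam s)) => //= /existsP[c /forallP sc].
    have labE i : flag_label grid_step lab s i = flag_label grid_step canonical_label s i.
      rewrite /flag_label /lab /canonical_label; congr first_failure.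
      by apply/boolp.funext => d; apply: gP (sc i) d.
    rewrite /full_flag labE; congr andb; apply: eq_injectiveb => i; exact: labE.
  rewrite -splitE (_ : [set s | _] = [set (const_mx (inZp h.-1), 1%g)]) ?cards1 //.
  by apply/setP => s; rewrite !inE canonical_full_flag.
have [->|[s]] := set_0Vmem [set s | ~~ seam s && full_flag grid_step lab s].
  by rewrite cards0.
rewrite inE => /andP[ns /andP[/injectiveP inj]]; rewrite first_failure_max => /forallP sg _.
have [f _ fK] := injF_bij inj.
exists (V s (@ord_max n.+1)), (fun c => V s (f (dir c))); split => // [c|c d].
  by have /first_failureP[] := fK (dir c).
have [a ak aE] := nonseam_coord d ns.
rewrite !aE; move: (if _ then _ else _) (if _ then _ else _) => [] []; lia.
Qed.

End Grid.

From mathcomp Require Import all_classical all_reals all_analysis.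
From mathcomp Require Import measurable_realfun.
Import numFieldNormedType.Exports.
Local Open Scope classical_set_scope.
Local Open Scope ring_scope.

(** * Zeros of outward pointing vector fields *)

Lemma row_norm_le (R : realType) n (x : 'rV[R]_n) (b : R) : 0 <= b ->
  (`|x| <= b) <-> (forall i, `|x 0 i| <= b).
Proof.
move=> b0; rewrite [`|x|]/Num.norm /= mx_normrE; split=> [h i|h].
  by apply: le_trans h; apply: (le_bigmax _ (fun ij => `|x ij.1 ij.2|) (0, i)).
by apply/bigmax_leP; split => // -[i j] _; rewrite ord1; apply: h.
Qed.

Section OutwardField.
Variable R : realType.

(** Far out [f] is deformed into the identity, whose signs on the boundary of a cube are those of
    the canonical labelling. The discrete lemma yields, on finer and finer grids, nearby points with
    opposite signs of each component; they accumulate at a zero of the deformed field, and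
    outwardness makes it a zero of [f]. *)
Lemma zero_of_outward_field n (f : 'I_n -> 'rV[R]_n -> R) (M : R) :
  (forall i, continuous (f i)) ->
  (forall x, M <= `|x| -> 0 < \sum_i f i x * x 0 i) ->
  exists x, forall i, f i x = 0.
Proof.
case: n f => [|n] f fc out; first by exists 0 => -[].
wlog M0 : M out / 0 < M.
  move=> /(_ (Num.max M 1)); apply; last by rewrite lt_max ltr01 orbT.
  by move=> x; rewrite ge_max => /andP[/out].
pose a (x : 'rV[R]_n.+1) := (`|x| - M) / M.
(* The positive part of [a]: 0 for norm at most [M], and 1 on the sphere of radius [2 * M]. *)
pose th (x : 'rV[R]_n.+1) := (a x + `|a x|) / 2.
pose g i (x : 'rV[R]_n.+1) := (1 - th x) * f i x + th x * x 0 i.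
have nc : continuous (fun x : 'rV[R]_n.+1 => `|x| : R) by exact: norm_continuous.
have thc : continuous th.
  move=> x; have ac : {for x, continuous a}.
    apply: continuousM; last exact: cst_continuous.
    by apply: continuousB; [exact: nc|exact: cst_continuous].
  apply: (@continuousM _ _ (fun x => a x + `|a x|) (fun=> 2^-1)); last exact: cst_continuous.
  apply: (@continuousD R R^o _ a (fun x => `|a x|)) => //.
  by apply: (continuous_comp ac); exact: norm_continuous.
have gc i : continuous (g i).
  move=> x; apply: (@continuousD R R^o _ (fun x => (1 - th x) * f i x) (fun x => th x * x 0 i));
    apply: continuousM.
  - by apply: continuousB; [exact: cst_continuous|exact: thc].
  - exact: fc.
  - exact: thc.
  - exact: coord_continuous.
pose L := 2 * M.
have L0 : 0 < L by rewrite /L; lra.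
pose B := [set v : 'rV[R]_n.+1 | forall i, v ord0 i \in `[(- L), L]].
have Bc : compact B.
  apply: (@rV_compact _  _ (fun=> `[(- L), L]%classic)) => _.
  exact: segment_compact.
(* An odd number of cells: 0 is not a grid coordinate, and a coordinate of [pt] is positive exactly
   from index [h.+2] on, the threshold of the canonical labelling. *)
pose k h := (2 * h + 3)%N.
pose pt (h : nat) (u : 'rV['I_(k h).+1]_n.+1) : 'rV[R]_n.+1 :=
  \row_i (L * ((u 0 i : nat)%:R * 2 / (k h)%:R - 1)).
have kpos h : 0 < (k h)%:R :> R by rewrite ltr0n /k; lia.
have ptB h u : B (pt h u).
  move=> i; rewrite mxE in_itv /=.
  have uk : (u 0 i : nat)%:R <= (k h)%:R :> R by rewrite ler_nat -ltnS.
  have : 0 <= (u 0 i : nat)%:R * 2 / (k h)%:R :> R by rewrite divr_ge0 ?mulr_ge0 // ltW.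
  have : (u 0 i : nat)%:R * 2 / (k h)%:R <= 2 :> R.
    by rewrite ler_pdivrMr // mulrC ler_pM2l.
  set z := _ / _ => z2 z0; apply/andP; split; nra.
have ptbd h (u : 'rV['I_(k h).+1]_n.+1) c : (u 0 c == 0 :> nat) || (u 0 c == (k h) :> nat) -> `|pt h u| = L.
  move=> uc; apply/eqP; rewrite eq_le; apply/andP; split.
    by apply/row_norm_le; [exact: ltW|] => i; have := ptB h u i; rewrite in_itv /= ler_norml.
  have : L = `|pt h u 0 c|.
    rewrite mxE; case/orP: uc => /eqP ->.
      by rewrite !mul0r sub0r mulrN1 normrN gtr0_norm.
    have -> : (k h)%:R * 2 / (k h)%:R - 1 = 1 :> R by field; rewrite gt_eqF.
    by rewrite mulr1 gtr0_norm.
  by move=> ->; have [+ _] := row_norm_le (pt h u) (normr_ge0 (pt h u)); apply.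
have step h : exists xy : 'rV[R]_n.+1 * ('I_n.+1 -> 'rV[R]_n.+1),
   [/\ B xy.1, forall i, 0 < g i xy.1, forall i, g i (xy.2 i) <= 0 &
     forall i, `|xy.1 - xy.2 i| <= L * 2 / (k h)%:R].
  have [//||x0 c|] := @grid_labelling n (k h) h.+2 _ _ (fun u d => 0 < g d (pt h u)).
  - by rewrite /k; lia.
  - move=> /ptbd nL d; rewrite /g.
    have -> : th (pt h x0) = 1.
      rewrite /th /a nL /L (_ : (2 * M - M) / M = 1) ?normr1; first by lra.
      by field; rewrite gt_eqF.
    rewrite subrr mul0r add0r mul1r mxE pmulr_rgt0 // subr_gt0 ltr_pdivlMr // mul1r.
    rewrite -natrM ltr_nat /k; lia.
  - move=> x [y [gx gy xy]]; exists (pt h x, fun i => pt h (y i)); split => //=.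
      by move=> i; have := gy i; rewrite -leNgt.
    have st : 0 < L * 2 / (k h)%:R by rewrite divr_gt0 ?mulr_gt0.
    move=> i; apply/row_norm_le; first exact: ltW.
    move=> d; rewrite !mxE.
    have -> : L * ((x 0 d : nat)%:R * 2 / (k h)%:R - 1) -
       L * ((y i 0 d : nat)%:R * 2 / (k h)%:R - 1) =
       (L * 2 / (k h)%:R) * ((x 0 d : nat)%:R - (y i 0 d : nat)%:R) by ring.
    rewrite normrM gtr0_norm //.
    rewrite -[leRHS]mulr1 ler_pM2l // ler_norml.
    have [] := xy i d; rewrite -!(ler_nat R) -!natr1 => h1 h2; apply/andP; split; lra.
have [xy /all_and4[xB xg yg xyd]] := choice step.
have FB : ((fun h => (xy h).1) @ \oo) B by exists 0%N => // h _; exact: xB.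
have [p [Bp clp]] := Bc _ (fmap_proper_filter _ _) FB.
(* A nonzero [g i p] would fix the sign of [g i] near [p], where points with both signs
   accumulate. *)
have gp0 i : g i p = 0.
  apply/eqP; apply: contraT => gp.
  have e0 : 0 < `|g i p| by rewrite normr_gt0.
  have /cvgrPdist_lt/(_ _ e0)/nbhs_ballP[r /= r0 rP] := gc i p.
  have [h0 h0P] : exists h0, forall h, (h0 <= h)%N -> L * 2 / (k h)%:R < r / 2.
    exists (Num.truncn (L * 2 / (r / 2))) => h le.
    rewrite ltr_pdivrMr // [ltRHS]mulrC -ltr_pdivrMr ?divr_gt0 //.
    apply: (lt_le_trans (truncnS_gt _)); rewrite ler_nat (leq_trans (_ : _ <= h.+1)%N) // /k; lia.
  have [||x [[h hle <-] xr]] := clp [set (xy h).1 | h in [set h | (h0 <= h)%N]] (ball p (r / 2)).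
  - by exists h0 => // h /= le; exists h.
  - by apply: nbhsx_ballx; rewrite divr_gt0.
  move: xr; rewrite -ball_normE /= => xr.
  have mesh := h0P h hle.
  have xin : `|p - (xy h).1| < r by apply: lt_le_trans xr _; lra.
  have yin : `|p - (xy h).2 i| < r.
    rewrite -(subrK (xy h).1 p) -addrA (le_lt_trans (ler_normD _ _)) //.
    rewrite [r]splitr ltrD // (le_lt_trans (xyd h i)) // mesh //.
  rewrite -ball_normE in rP; have := rP _ xin; have := rP _ yin => /=.
  have gx := xg h i; have gy := yg h i.
  rewrite !ltr_norml; case: (ltrgt0P (g i p)) gp => // gp _; lra.
exists p => i.
have sum0 : \sum_i g i p * p 0 i = 0 by apply: big1 => j _; rewrite gp0 mul0r.
have sumE : \sum_i g i p * p 0 i =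
    (1 - th p) * (\sum_i f i p * p 0 i) + th p * \sum_i p 0 i ^+ 2.
  rewrite !mulr_sumr -big_split; apply: eq_bigr => j _ /=; rewrite /g; ring.
have pL : `|p| <= L.
  by apply/row_norm_le; [exact: ltW|] => j; have := Bp j; rewrite in_itv /= ler_norml.
have aleq : a p <= 1 by rewrite /a ler_pdivrMr // mul1r; move: pL; rewrite /L; lra.
(* Inside radius [M] the field [g] is [f]. Outside, both terms of [sumE] are nonnegative and do not
   vanish together, against [sum0]. *)
have [pM|pM] := leP M `|p|; last first.
  have a0 : a p < 0 by rewrite /a pmulr_llt0 ?invr_gt0 // subr_lt0.
  by have := gp0 i; rewrite /g /th ltr0_norm // subrr mul0r subr0 mul1r mul0r addr0.
have a0 : 0 <= a p by rewrite /a divr_ge0 ?subr_ge0 // ltW.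
have thE : th p = a p by rewrite /th ger0_norm //; lra.
have fpos := out p pM.
have ppos : 0 < \sum_i p 0 i ^+ 2.
  rewrite lt_neqAle sumr_ge0 ?andbT; last by move=> j _; exact: sqr_ge0.
  rewrite eq_sym psumr_neq0; last by move=> j _; exact: sqr_ge0.
  apply/hasP; case: (pselect (exists j, p 0 j != 0)) => [[j pj]|np].
    by exists j; rewrite ?mem_index_enum //= lt_neqAle sqr_ge0 eq_sym sqrf_eq0 pj.
  suff p0 : p = 0 by move: pM; rewrite p0 normr0 leNgt M0.
  apply/rowP => j; rewrite mxE; apply/eqP; apply: contraT => pj.
  by exfalso; apply: np; exists j.
suff : 0 < \sum_i g i p * p 0 i by rewrite sum0 ltxx.
rewrite sumE thE; have [a1|a1] := eqVneq (a p) 1; first by rewrite a1 subrr mul0r add0r mul1r.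
apply: ltr_pwDl; last exact: mulr_ge0 a0 (ltW ppos).
by rewrite mulr_gt0 // subr_gt0 lt_neqAle a1 aleq.
Qed.
End OutwardField.

Lemma sumr_continuous (R : realType) (T : topologicalType) (I : finType) (F : I -> T -> R) :
  (forall i, continuous (F i)) -> continuous (fun x => \sum_i F i x).
Proof.
move=> Fc; apply: continuous_big => // -[x y].
by apply: (@cvgD R R^o); [exact: cvg_fst|exact: cvg_snd].
Qed.

Lemma mulmxr_continuous (R : realType) n (A : 'M[R]_n) :
  continuous (fun x : 'rV[R]_n => x *m A).
Proof.
move=> x; apply/(@cvgrPdist_le R 'rV[R]_n 'rV[R]_n (nbhs x) (nbhs_filter x)) => e e0; near=> y.
apply/row_norm_le; first exact: ltW.
near: y; apply: filter_forall => j.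
have /cvgrPdist_le/(_ _ e0) : (fun y : 'rV[R]_n => (y *m A) 0 j) @ x --> (x *m A) 0 j.
  have -> : (fun y : 'rV[R]_n => (y *m A) 0 j) = (fun y => \sum_i y 0 i * A i j).
    by apply/funext => y; rewrite mxE.
  rewrite mxE; apply: sumr_continuous => i {}x.
  by apply: continuousM; [exact: coord_continuous|exact: cst_continuous].
by rewrite mxE; apply: filterS => y; rewrite !mxE.
Unshelve. all: by end_near. Qed.

Section OutwardSubspace.
Variables (R : realType) (n : nat) (P : 'M[R]_n) (F : 'rV[R]_n -> 'rV[R]_n -> R).
Hypothesis P_idem : P *m P = P.
Hypothesis F_linear : forall x a u v, F x (a *: u + v) = a * F x u + F x v.
Hypothesis F_continuous : forall v, continuous (F^~ v).

(** The field is completed to the whole space by the component in the kernel of [P]: with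
    [Q = 1 - P], the sum of [F] at the [P]-parts and of the scalar product of the [Q]-parts points
    outwards far from the origin. *)
Lemma zero_on_subspace (M C : R) :
  (forall y, y *m P = y -> - C <= F y y) ->
  (forall y, y *m P = y -> M <= `|y| -> 0 < F y y) ->
  exists2 y, y *m P = y & forall w, w *m P = w -> F y w = 0.
Proof.
move=> bnd coer.
have F0 x : F x 0 = 0.
  by have := F_linear x 1 0 0; rewrite scale1r addr0 mul1r => h; apply: (addrI (F x 0)); rewrite addr0 -h.
have Fsum x (I : finType) (c : I -> R) (u : I -> 'rV[R]_n) :
    F x (\sum_i c i *: u i) = \sum_i c i * F x (u i).
  by elim/big_rec2: _ => [|i _ b _ <-]; rewrite ?F0 ?F_linear.
pose dot (u v : 'rV[R]_n) := \sum_j u 0 j * v 0 j.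
pose Q : 'M[R]_n := 1%:M - P.
pose f i (x : 'rV[R]_n) := F (x *m P) (row i P) + dot (x *m Q) (row i Q).
have fE x (w : 'rV[R]_n) : \sum_i f i x * w 0 i = F (x *m P) (w *m P) + dot (x *m Q) (w *m Q).
  rewrite [w *m P](mulmx_sum_row w) [w *m Q](mulmx_sum_row w) Fsum.
  rewrite /dot (eq_bigr (fun i => w 0 i * F (x *m P) (row i P)
     + w 0 i * dot (x *m Q) (row i Q))) => [|i _]; last by rewrite /f; ring.
  rewrite big_split; congr (_ + _) => /=; rewrite /dot.
  under eq_bigr do rewrite mulr_sumr.
  rewrite exchange_big; apply: eq_bigr => j _; rewrite summxE mulr_sumr.
  by apply: eq_bigr => i _; rewrite !mxE; ring.
have QE x : x *m Q = x - x *m P by rewrite /Q mulmxBr mulmx1.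
(* If [x *m P] is shorter than [M], this radius leaves at least [|C| + 1] for [x *m Q], whose square
   outweighs the lower bound [- C]. *)
have [||y fy] := @zero_of_outward_field R n f (`|M| + `|C| + 1).
- move=> i x; apply: (@continuousD R R^o _ (fun x : 'rV[R]_n => F (x *m P) (row i P))
    (fun x : 'rV[R]_n => dot (x *m Q) (row i Q))).
    by apply: (@continuous_comp _ _ _ (fun x : 'rV[R]_n => x *m P) (F^~ (row i P)));
      [exact: mulmxr_continuous|exact: F_continuous].
  apply: sumr_continuous => j {}x; apply: continuousM; last exact: cst_continuous.
  by apply: (@continuous_comp _ _ _ (fun x : 'rV[R]_n => x *m Q) (fun y : 'rV[R]_n => y 0 j));
    [exact: mulmxr_continuous|exact: coord_continuous].
- move=> x xM; rewrite fE.
  have PP : (x *m P) *m P = x *m P by rewrite -mulmxA P_idem.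
  have qq : `|x *m Q| ^+ 2 <= dot (x *m Q) (x *m Q).
    have [->|] := eqVneq `|x *m Q| 0.
      by rewrite expr0n /=; apply: sumr_ge0 => j _; rewrite -expr2 sqr_ge0.
    case/mx_norm_neq0 => -[i j] /= e.
    rewrite (e : `|x *m Q| = _) ord1 real_normK ?num_real //.
    rewrite /dot (bigD1 j) //= -expr2 lerDl; apply: sumr_ge0 => k _.
    by rewrite -expr2 sqr_ge0.
  have [big|small] := leP M `|x *m P|.
    by rewrite ltr_pwDl ?coer // (le_trans _ qq) // sqr_ge0.
  have : `|C| + 1 <= `|x *m Q|.
    have := ler_normD (x *m P) (x *m Q); rewrite QE addrC subrK => tri.
    have := ler_norm M; lra.
  have := bnd _ PP; have := ler_norm C; have := normr_ge0 C; nra.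
have fy0 w : F (y *m P) (w *m P) + dot (y *m Q) (w *m Q) = 0.
  by rewrite -fE; apply: big1 => i _; rewrite fy mul0r.
have PQ : P *m Q = 0 by rewrite /Q mulmxBr mulmx1 P_idem subrr.
have QQ : Q *m Q = Q by rewrite {1}/Q mulmxBl mul1mx PQ subr0.
exists (y *m P) => [|w wP]; first by rewrite -mulmxA P_idem.
have := fy0 w; rewrite wP -{2}wP -mulmxA PQ mulmx0 /dot.
by rewrite [X in _ + X]big1 ?addr0 // => j _; rewrite [X in _ * X]mxE mulr0.
Qed.
End OutwardSubspace.

(** * The nodal system *)

Section Element.
Variable R : realType.

(* The integral over an interval of length [h] of the product of two affine
   functions, given by their end point values. *)
Definition mass (h al be v0 v1 : R) : R :=
  h / 6 * (2 * al * v0 + al * v1 + be * v0 + 2 * be * v1).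

Definition slope (h al be : R) : R := (be - al) / h.

Definition density (h r0 tau al be : R) : R := r0 - tau * slope h al be.

(* Contribution of one mesh element to the momentum balance, tested with the
   affine function of end point values [v0], [v1]; [p] and [q] are the values
   of the pressure and of the friction term. *)
Definition element_form (h r0 p0 p1 a b tau r p q al be v0 v1 : R) : R :=
  mass h (al - p0) (be - p1) v0 v1 / (tau * r0)
  + slope h al be / r ^+ 2 * mass h al be v0 v1
  - slope h v0 v1 / (2 * r ^+ 2) * mass h al be al be
  + (a * slope h al be / r ^+ 2 - p) * slope h v0 v1 * h
  + b / r ^+ 2 * q.

Lemma mass_coercive (h al be : R) : 0 <= h ->
  h / 6 * (al ^+ 2 + be ^+ 2) <= mass h al be al be.
Proof. by move=> h0; rewrite /mass ler_wpM2l ?divr_ge0 //; have := sqr_ge0 (al + be); nra. Qed.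

Lemma mass_ge0 (h al be : R) : 0 <= h -> 0 <= mass h al be al be.
Proof.
move=> h0; apply: le_trans (mass_coercive _ _ h0).
by rewrite mulr_ge0 ?divr_ge0 // addr_ge0 ?sqr_ge0.
Qed.

(** By polarization inertia yields one half of the new mass term: 3/8 are kept, and 1/8 absorbs the
    transport term in [key]. The relation between [r] and the slope is asked for nonpositive slopes
    only, which admits truncated densities. *)
Lemma element_energy (h r0 p0 p1 a b tau r p q al be : R) :
  0 < h -> 0 < r0 -> 0 < tau -> 0 <= b -> 0 <= q -> 0 < r ->
  (slope h al be <= 0 -> r = density h r0 tau al be) ->
  3 / (8 * (tau * r0)) * mass h al be al be - mass h p0 p1 p0 p1 / (2 * (tau * r0))
   + (a * slope h al be ^+ 2 / r ^+ 2 - p * slope h al be) * h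
  <= element_form h r0 p0 p1 a b tau r p q al be al be.
Proof.
move=> h0 r00 tau0 b0 q0 rpos rE; rewrite -subr_ge0.
have -> : element_form h r0 p0 p1 a b tau r p q al be al be -
    (3 / (8 * (tau * r0)) * mass h al be al be - mass h p0 p1 p0 p1 / (2 * (tau * r0))
   + (a * slope h al be ^+ 2 / r ^+ 2 - p * slope h al be) * h) =
   mass h (al - p0) (be - p1) (al - p0) (be - p1) / (2 * (tau * r0))
   + (1 / (8 * (tau * r0)) + slope h al be / (2 * r ^+ 2)) * mass h al be al be
   + b / r ^+ 2 * q.
  rewrite /element_form /mass /slope; field.
  by rewrite !gt_eqF.
have m0 := mass_ge0 al be (ltW h0).
have key : 0 <= 1 / (8 * (tau * r0)) + slope h al be / (2 * r ^+ 2).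
  have [s0|s0] := leP (slope h al be) 0; last first.
    have d0 : 0 <= 8 * (tau * r0) by rewrite !mulr_ge0 // ltW.
    by apply: addr_ge0; apply: divr_ge0 => //; [exact: ltW|rewrite mulr_ge0 ?sqr_ge0].
  have sE : slope h al be = (r0 - r) / tau by rewrite rE // /density; field; rewrite gt_eqF.
  have -> : 1 / (8 * (tau * r0)) + slope h al be / (2 * r ^+ 2) =
     (r - 2 * r0) ^+ 2 / (8 * (tau * r0) * r ^+ 2).
    by rewrite sE; field; rewrite !gt_eqF.
  have d0 : 0 <= 8 * (tau * r0) by rewrite !mulr_ge0 // ltW.
  by rewrite divr_ge0 ?sqr_ge0 // mulr_ge0 ?sqr_ge0.
apply: addr_ge0; [apply: addr_ge0|].
- have d0 : 0 <= 2 * (tau * r0) by rewrite !mulr_ge0 // ltW.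
  by rewrite divr_ge0 // mass_ge0 // ltW.
- exact: mulr_ge0.
- by rewrite mulr_ge0 // divr_ge0 // sqr_ge0.
Qed.

(* Young's inequality absorbs the pressure at the price of a constant that
   depends neither on the time step nor on the density. *)
Lemma element_energy_uniform (h r0 p0 p1 a b tau r p q al be P0 : R) :
  0 < h -> 0 < r0 -> 0 < tau <= 1 -> 0 <= a -> 0 <= b -> 0 <= q -> 0 < r ->
  (slope h al be <= 0 -> r = density h r0 tau al be) ->
  0 <= p -> (0 < slope h al be -> p <= P0) -> 0 <= P0 ->
  h / (32 * r0) * (al ^+ 2 + be ^+ 2)
   - (mass h p0 p1 p0 p1 / (2 * r0) + 16 * r0 / h * P0 ^+ 2)
  <= tau * element_form h r0 p0 p1 a b tau r p q al be al be.
Proof.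
move=> h0 r00 /andP[tau0 tau1] a0 b0 q0 rpos rE p_ge0 pP0 P00.
apply: le_trans (ler_wpM2l (ltW tau0) (element_energy p0 p1 a p h0 r00 tau0 b0 q0 rpos rE)).
have [tau_ge0 h_ge0 r0_ge0] := And3 (ltW tau0) (ltW h0) (ltW r00).
set s := slope h al be.
have sh : s * h = be - al by rewrite /s /slope divfK ?gt_eqF.
have -> : tau * (3 / (8 * (tau * r0)) * mass h al be al be - mass h p0 p1 p0 p1 / (2 * (tau * r0))
   + (a * s ^+ 2 / r ^+ 2 - p * s) * h) =
   3 / (8 * r0) * mass h al be al be - mass h p0 p1 p0 p1 / (2 * r0)
   + tau * (a * s ^+ 2 / r ^+ 2 * h) - tau * (p * (be - al)).
  by rewrite -sh; field; rewrite !gt_eqF.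
have t0 : 0 <= tau * (a * s ^+ 2 / r ^+ 2 * h).
  have r2 : 0 <= (r ^+ 2)^-1 by rewrite invr_ge0 sqr_ge0.
  by rewrite mulr_ge0 // mulr_ge0 // mulr_ge0 // mulr_ge0 // sqr_ge0.
(* Only for a positive slope has the pressure the wrong sign; [tau <= 1] removes the time step from
   the bound. *)
have t1 : tau * (p * (be - al)) <= P0 * (`|al| + `|be|).
  have [sle|sgt] := leP s 0.
    have : be - al <= 0 by rewrite -sh; nra.
    have := normr_ge0 al; have := normr_ge0 be => A B C.
    apply: (@le_trans _ _ 0); last by rewrite mulr_ge0 // addr_ge0.
    by rewrite mulr_ge0_le0 // mulr_ge0_le0.
  have pp := pP0 sgt.
  have bal : 0 <= be - al by rewrite -sh; nra.
  have le : be - al <= `|al| + `|be| by have := ler_norm be; have := lerNnormlW (lexx `|al|); lra.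
  apply: (@le_trans _ _ (1 * (p * (be - al)))).
    by rewrite ler_wpM2r // mulr_ge0.
  by rewrite mul1r; apply: ler_pM.
have m1 := mass_coercive al be (ltW h0).
(* The factor 3/8 times the coercivity constant 1/6 is 1/16. Half of it is kept, the other half
   absorbs the pressure. *)
have m2 : h / (16 * r0) * (al ^+ 2 + be ^+ 2) <= 3 / (8 * r0) * mass h al be al be.
  apply: le_trans (ler_wpM2l _ m1); last by rewrite divr_ge0 // mulr_ge0.
  by rewrite le_eqVlt; apply/orP; left; apply/eqP; field; rewrite !gt_eqF.
have young (x : R) : P0 * `|x| <= h / (32 * r0) * x ^+ 2 + 8 * r0 / h * P0 ^+ 2.
  rewrite -subr_ge0 -(real_normK (num_real x)).
  have -> : h / (32 * r0) * `|x| ^+ 2 + 8 * r0 / h * P0 ^+ 2 - P0 * `|x| =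
     (h * `|x| - 16 * r0 * P0) ^+ 2 / (32 * r0 * h) by field; rewrite !gt_eqF.
  by rewrite divr_ge0 ?sqr_ge0 // !mulr_ge0.
have y1 := young al; have y2 := young be.
rewrite (_ : 16 * r0 / h * P0 ^+ 2 = 8 * r0 / h * P0 ^+ 2 + 8 * r0 / h * P0 ^+ 2);
  last by field; rewrite gt_eqF.
have e16 : h / (16 * r0) * (al ^+ 2 + be ^+ 2) =
   h / (32 * r0) * (al ^+ 2 + be ^+ 2) + h / (32 * r0) * al ^+ 2 + h / (32 * r0) * be ^+ 2.
  by field; rewrite gt_eqF.
have : P0 * (`|al| + `|be|) = P0 * `|al| + P0 * `|be| by rewrite mulrDr.
rewrite e16 in m2; lra.
Qed.

End Element.

(** For a positive slope there are two cases. A density of at least [d] forces [s <= r0 / tau],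
    which limits the work of the pressure. A density below [d] forces [s >= r0 / (2 * tau)], and
    dissipation then carries the factor [1 / d ^ 2]: the second bound exceeds any given energy once
    [d] is small. *)
Lemma dissipation_lower_bound (R : realType) (h r0 a tau d p P0 al be : R) :
  let s := slope h al be in
  let r := Num.max (density h r0 tau al be) d in
  0 < r0 -> 0 < tau -> 0 <= a -> 0 < d -> 2 * d <= r0 -> 0 <= p -> 0 <= P0 ->
  (0 < s -> p <= P0) -> P0 <= a * r0 / (2 * tau * d ^+ 2) ->
  - (P0 * r0 / tau) <= a * s ^+ 2 / r ^+ 2 - p * s /\
  (density h r0 tau al be < d ->
   r0 / (2 * tau) * (a * r0 / (2 * tau * d ^+ 2) - P0) <= a * s ^+ 2 / r ^+ 2 - p * s).
Proof.
move=> s r r00 tau0 a0 d0 dr0 p0 P00 pP0 big.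
have Pr : 0 <= P0 * r0 / tau by rewrite divr_ge0 ?mulr_ge0 // ltW.
have dis : 0 <= a * s ^+ 2 / r ^+ 2.
  by apply: divr_ge0; [rewrite mulr_ge0 // sqr_ge0|rewrite sqr_ge0].
have [s0|s0] := leP s 0.
  have rs : r0 <= density h r0 tau al be by rewrite /density -/s; nra.
  split; last by move=> lt; exfalso; lra.
  have : p * s <= 0 by rewrite mulr_ge0_le0.
  lra.
have pP := pP0 s0.
have [dd|dd] := leP d (density h r0 tau al be).
  split=> //; have sr : s <= r0 / tau.
    by rewrite ler_pdivlMr //; move: dd; rewrite /density -/s; lra.
  have : p * s <= P0 * (r0 / tau) by apply: ler_pM => //; exact: ltW.
  by rewrite mulrA; lra.
have rE : r = d by rewrite /r max_r // ltW.
have sr : r0 / (2 * tau) <= s.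
  rewrite ler_pdivrMr ?mulr_gt0 //; move: dd; rewrite /density -/s; lra.
have main : r0 / (2 * tau) * (a * r0 / (2 * tau * d ^+ 2) - P0) <=
    a * s ^+ 2 / r ^+ 2 - p * s.
  apply: (@le_trans _ _ (s * (a * r0 / (2 * tau * d ^+ 2) - P0))).
    by rewrite ler_wpM2r // subr_ge0.
  have : p * s <= P0 * s by rewrite ler_wpM2r // ltW.
  have : s * (a * r0 / (2 * tau * d ^+ 2)) <= a * s ^+ 2 / r ^+ 2.
    rewrite rE (_ : s * (a * r0 / (2 * tau * d ^+ 2)) = (a * s / d ^+ 2) * (r0 / (2 * tau))); last first.
      by field; rewrite !gt_eqF.
    rewrite (_ : a * s ^+ 2 / d ^+ 2 = (a * s / d ^+ 2) * s); last by field; rewrite gt_eqF.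
    apply: ler_wpM2l => //; apply: divr_ge0; last exact: sqr_ge0.
    by rewrite mulr_ge0 // ltW.
  by rewrite mulrBr [P0 * s]mulrC; lra.
split=> //; apply: le_trans main; apply: (@le_trans _ _ 0); first by rewrite oppr_le0.
by apply: mulr_ge0; rewrite ?subr_ge0 // divr_ge0 ?(ltW r00) // mulr_ge0 // ltW.
Qed.

Section ContinuityRules.
Variables (R : realType) (T : topologicalType).
Implicit Types f g : T -> R.

Lemma fcontD f g : continuous f -> continuous g -> continuous (fun x => f x + g x).
Proof. by move=> fc gc x; apply: (@continuousD R R^o _ f g); [exact: fc|exact: gc]. Qed.

Lemma fcontB f g : continuous f -> continuous g -> continuous (fun x => f x - g x).
Proof. by move=> fc gc x; apply: (@continuousB R R^o _ f g); [exact: fc|exact: gc]. Qed.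

Lemma fcontM f g : continuous f -> continuous g -> continuous (fun x => f x * g x).
Proof. by move=> fc gc x; apply: (@continuousM _ _ f g); [exact: fc|exact: gc]. Qed.

Lemma fcontV f : (forall x, f x != 0) -> continuous f -> continuous (fun x => (f x)^-1).
Proof. by move=> f0 fc x; apply: continuousV => //; exact: fc. Qed.

Lemma fcontX f n : continuous f -> continuous (fun x => f x ^+ n).
Proof.
move=> fc; elim: n => [|n IH]; first by move=> x; exact: cst_continuous.
by under eq_fun do rewrite exprS; exact: fcontM.
Qed.

Lemma fcont_norm f : continuous f -> continuous (fun x => `|f x|).
Proof. by move=> fc x; apply: (continuous_comp (fc x)); exact: norm_continuous. Qed.

Lemma fcont_max f g : continuous f -> continuous g -> continuous (fun x => Num.max (f x) (g x)).
Proof. by move=> fc gc x; apply: (@continuous_max _ _ f g); [exact: fc|exact: gc]. Qed.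

Lemma fcont_dominated f (w : T -> T -> R) :
  (forall x, continuous (w x)) -> (forall x, w x x = 0) ->
  (forall x y, `|f x - f y| <= w x y) -> continuous f.
Proof.
move=> wc w0 fw x; apply/cvgrPdist_lt => e e0.
have /cvgrPdist_lt/(_ _ e0) := wc x x; apply: filterS => y.
rewrite w0 sub0r normrN; apply: le_lt_trans; apply: le_trans (fw x y) _.
exact: ler_norm.
Qed.

End ContinuityRules.

(** * Lipschitz estimates uniform in the time step *)

Section Lipschitz.
Variables (R : realType) (h r0 B : R).
Hypotheses (h_gt0 : 0 < h) (r0_gt0 : 0 < r0).

Definition admissible (tau al be : R) : Prop :=
  [/\ 0 < tau <= 1, `|al| <= B, `|be| <= B & r0 / 2 <= density h r0 tau al be].

(** One constant serves all time steps; boundedness is included to make the class closed under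
    products. *)
Definition ulip (f : R -> R -> R -> R) : Prop := exists2 C, 0 <= C &
  forall tau al be al' be', admissible tau al be -> admissible tau al' be' ->
  `|f tau al be| <= C /\
  `|f tau al be - f tau al' be'| <= C * (`|al - al'| + `|be - be'|).

Lemma ulip_cst (c : R) : ulip (fun _ _ _ => c).
Proof.
exists `|c| => // tau al be al' be' _ _; split => //.
by rewrite subrr normr0 mulr_ge0 // addr_ge0.
Qed.

Lemma ulip_al : ulip (fun _ al _ => al).
Proof.
exists (`|B| + 1) => [|tau al be al' be' [_ alB _ _] _]; first by rewrite addr_ge0.
split; first by have := ler_norm B; lra.
by have := normr_ge0 (al - al'); have := normr_ge0 (be - be'); have := normr_ge0 B; nra.
Qed.

Lemma ulip_be : ulip (fun _ _ be => be).
Proof.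
exists (`|B| + 1) => [|tau al be al' be' [_ _ beB _] _]; first by rewrite addr_ge0.
split; first by have := ler_norm B; lra.
by have := normr_ge0 (al - al'); have := normr_ge0 (be - be'); have := normr_ge0 B; nra.
Qed.

Lemma ulipD f g : ulip f -> ulip g -> ulip (fun t x y => f t x y + g t x y).
Proof.
move=> [C C0 fC] [D D0 gD]; exists (C + D); first exact: addr_ge0.
move=> tau al be al' be' A A'.
have [f1 f2] := fC _ _ _ _ _ A A'; have [g1 g2] := gD _ _ _ _ _ A A'.
split; first by rewrite (le_trans (ler_normD _ _)) // lerD.
rewrite (_ : _ - _ = (f tau al be - f tau al' be') + (g tau al be - g tau al' be')); last by ring.
by rewrite (le_trans (ler_normD _ _)) // mulrDl lerD.
Qed.

Lemma ulipM f g : ulip f -> ulip g -> ulip (fun t x y => f t x y * g t x y).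
Proof.
move=> [C C0 fC] [D D0 gD]; exists (2 * (C * D)); first by rewrite !mulr_ge0.
move=> tau al be al' be' A A'.
have [f1 f2] := fC _ _ _ _ _ A A'; have [g1 g2] := gD _ _ _ _ _ A A'.
have [g1' _] := gD _ _ _ _ _ A' A.
split; first by rewrite normrM (le_trans (ler_pM _ _ f1 g1)) // ler_peMl ?mulr_ge0 // ler1n.
rewrite (_ : _ - _ = f tau al be * (g tau al be - g tau al' be')
  + (f tau al be - f tau al' be') * g tau al' be'); last by ring.
rewrite (le_trans (ler_normD _ _)) // !normrM.
have := ler_pM (normr_ge0 _) (normr_ge0 _) f1 g2.
have := ler_pM (normr_ge0 _) (normr_ge0 _) f2 g1'.
lra.
Qed.

Lemma ulip_slope : ulip (fun _ al be => slope h al be).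
Proof.
apply: ulipM; last exact: ulip_cst.
have := ulipD ulip_be (ulipM (ulip_cst (-1)) ulip_al).
by under eq_fun3 do rewrite mulN1r.
Qed.

(** On admissible values the inverses are at most [2 / r0], and [tau <= 1] bounds the factor
    [tau / h] of the slope differences by [1 / h]. *)
Lemma ulip_inv_density : ulip (fun tau al be => (density h r0 tau al be)^-1).
Proof.
exists (2 / r0 + 4 / (h * r0 ^+ 2)) => [|tau al be al' be' [t01 _ _ d1] [_ _ _ d2]].
  by rewrite addr_ge0 // divr_ge0 // ?mulr_ge0 ?sqr_ge0 // ltW.
have {t01} [t0 t1] := andP t01.
have rr : 0 < r0 / 2 by rewrite divr_gt0.
have D1 := lt_le_trans rr d1; have D2 := lt_le_trans rr d2.
have i1 : (density h r0 tau al be)^-1 <= 2 / r0.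
  by rewrite -[2 / r0]invrK invf_div lef_pV2.
have i2 : (density h r0 tau al' be')^-1 <= 2 / r0.
  by rewrite -[2 / r0]invrK invf_div lef_pV2.
have C1 : 0 <= 2 / r0 by rewrite divr_ge0 // ltW.
have C2 : 0 <= 4 / (h * r0 ^+ 2) by rewrite divr_ge0 // mulr_ge0 ?sqr_ge0 // ltW.
split; first by rewrite gtr0_norm ?invr_gt0 // (le_trans i1) // lerDl.
have -> : (density h r0 tau al be)^-1 - (density h r0 tau al' be')^-1 =
  (density h r0 tau al be)^-1 * (density h r0 tau al' be')^-1 *
  (density h r0 tau al' be' - density h r0 tau al be) by field; rewrite !gt_eqF.
have -> : density h r0 tau al' be' - density h r0 tau al be =
  (tau / h) * ((be - be') - (al - al')) by rewrite /density /slope; field; rewrite gt_eqF.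
have n1 : `|(density h r0 tau al be)^-1| = (density h r0 tau al be)^-1.
  by rewrite gtr0_norm ?invr_gt0.
have n2 : `|(density h r0 tau al' be')^-1| = (density h r0 tau al' be')^-1.
  by rewrite gtr0_norm ?invr_gt0.
have n3 : `|tau / h| = tau / h by rewrite gtr0_norm ?divr_gt0.
rewrite normrM [X in X * _]normrM n1 n2 normrM n3.
apply: (@le_trans _ _ (4 / (h * r0 ^+ 2) * (`|al - al'| + `|be - be'|))); last first.
  by rewrite ler_wpM2r ?addr_ge0 // lerDr.
rewrite (_ : 4 / (h * r0 ^+ 2) = (2 / r0 * (2 / r0)) * h^-1); last by field; rewrite !gt_eqF.
rewrite -[leRHS]mulrA; apply: ler_pM.
- by rewrite mulr_ge0 ?invr_ge0 // ltW.
- by rewrite mulr_ge0 // divr_ge0 // ltW.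
- by apply: ler_pM => //; rewrite invr_ge0 ltW.
- apply: ler_pM => //; first by rewrite divr_ge0 // ltW.
    by rewrite ler_pdivrMr // mulVf // gt_eqF.
  by rewrite [leRHS]addrC; exact: ler_normB.
Qed.

(* The inertial term and the pressure are taken out: they are monotone. *)
Lemma element_form_lipschitz (a b p0 p1 : R) (cub : R -> R -> R -> R -> R) :
  0 <= b ->
  (forall v0 v1, cub 0 0 v0 v1 = 0) ->
  (forall al be al' be' v0 v1,
    `|cub al be v0 v1 - cub al' be' v0 v1| <=
    (`|al| + `|be| + `|al'| + `|be'|) * (`|al - al'| + `|be - be'|) * (`|v0| + `|v1|) * h) ->
  exists2 C, 0 <= C & forall tau al be al' be' p p' v0 v1,
    admissible tau al be -> admissible tau al' be' ->
    `| element_form h r0 p0 p1 a b tau (density h r0 tau al be) p (cub al be v0 v1) al be v0 v1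
     - element_form h r0 p0 p1 a b tau (density h r0 tau al' be') p' (cub al' be' v0 v1) al' be' v0 v1
     - mass h (al - al') (be - be') v0 v1 / (tau * r0) + (p - p') * slope h v0 v1 * h |
    <= C * (`|al - al'| + `|be - be'|) * (`|v0| + `|v1|).
Proof.
move=> b0 cub0 cub_lip.
have q := ulipM ulip_inv_density ulip_inv_density.
have sq := ulipM ulip_slope q.
have mm : ulip (fun _ al be => mass h al be al be).
  have aa := ulipM ulip_al ulip_al; have ab := ulipM ulip_al ulip_be.
  have bb := ulipM ulip_be ulip_be.
  have := ulipM (ulip_cst (h / 3)) (ulipD (ulipD aa ab) bb).
  by congr ulip; apply/funext => t; apply/funext => x; apply/funext => y; rewrite /mass; field.
(* [base] collects what [slope h v0 v1] contributes. Apart from inertia, pressure and friction, [F0]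
   and [F1] are the coefficients of [v0] and [v1]. *)
have base := ulipD (ulipM (ulipM (ulip_cst (2^-1 / h)) q) mm) (ulipM (ulip_cst (- a)) sq).
have F0 := ulipD (ulipM sq (ulipM (ulip_cst (h / 6))
  (ulipD (ulipM (ulip_cst 2) ulip_al) ulip_be))) base.
have F1 := ulipD (ulipM sq (ulipM (ulip_cst (h / 6))
  (ulipD ulip_al (ulipM (ulip_cst 2) ulip_be)))) (ulipM (ulip_cst (-1)) base).
case: F0 => C0 C00 F0; case: F1 => C1 C10 F1; case: q => Cq Cq0 q {sq mm base}.
exists (C0 + C1 + b * (Cq * (4 * `|B|) * h + Cq * (4 * `|B| ^+ 2) * h)).
  by rewrite !(addr_ge0, mulr_ge0) // ?sqr_ge0 // ltW.
move=> tau al be al' be' p p' v0 v1 A A'.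
have [_ {}F0] := F0 _ _ _ _ _ A A'; have [_ {}F1] := F1 _ _ _ _ _ A A'.
have [q1 q2] := q _ _ _ _ _ A A'; cbv beta in F0, F1, q1, q2.
set e := `|al - al'| + `|be - be'| in F0 F1 q2 *.
set V := `|v0| + `|v1|.
set D := density h r0 tau al be in F0 F1 q1 q2 *.
set D' := density h r0 tau al' be' in F0 F1 q2 *.
have [alB beB] : `|al| <= `|B| /\ `|be| <= `|B|.
  by have [_ h1 h2 _] := A; split; [exact: le_trans h1 (ler_norm _)|exact: le_trans h2 (ler_norm _)].
have [alB' beB'] : `|al'| <= `|B| /\ `|be'| <= `|B|.
  by have [_ h1 h2 _] := A'; split; [exact: le_trans h1 (ler_norm _)|exact: le_trans h2 (ler_norm _)].
have e0 : 0 <= e by rewrite addr_ge0.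
have V0 : 0 <= V by rewrite addr_ge0.
have [D0 D0'] : D != 0 /\ D' != 0.
  have rr : 0 < r0 / 2 by rewrite divr_gt0.
  by have [_ _ _ d1] := A; have [_ _ _ d2] := A'; split; rewrite gt_eqF // (lt_le_trans rr).
have cub_diff : `|cub al be v0 v1 - cub al' be' v0 v1| <= 4 * `|B| * e * V * h.
  apply: le_trans (cub_lip _ _ _ _ _ _) _; rewrite -/e -/V.
  rewrite ler_wpM2r ?(ltW h_gt0) // ler_wpM2r // ler_wpM2r //; lra.
have cub_bound : `|cub al' be' v0 v1| <= 4 * `|B| ^+ 2 * V * h.
  have := cub_lip al' be' 0 0 v0 v1; rewrite cub0 !subr0 normr0 !addr0 -/V => H.
  apply: le_trans H _; rewrite ler_wpM2r ?(ltW h_gt0) // ler_wpM2r //.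
  rewrite (_ : 4 * `|B| ^+ 2 = (2 * `|B|) * (2 * `|B|)); last by ring.
  by apply: ler_pM; rewrite ?addr_ge0 //; lra.
have [Q QE] : exists Q, D^-1 * D^-1 = Q by eexists.
have [Q' QE'] : exists Q', D'^-1 * D'^-1 = Q' by eexists.
rewrite QE ?QE' in F0 F1 q1 q2.
have qpart : `|b * (Q * cub al be v0 v1 - Q' * cub al' be' v0 v1)| <=
    b * (Cq * (4 * `|B|) * h + Cq * (4 * `|B| ^+ 2) * h) * e * V.
  rewrite normrM (ger0_norm b0) -2!(mulrA b); apply: ler_wpM2l => //.
  rewrite (_ : Q * cub al be v0 v1 - Q' * cub al' be' v0 v1 =
    Q * (cub al be v0 v1 - cub al' be' v0 v1) + (Q - Q') * cub al' be' v0 v1); last by ring.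
  rewrite (le_trans (ler_normD _ _)) // !normrM.
  have := ler_pM (normr_ge0 _) (normr_ge0 _) q1 cub_diff.
  have := ler_pM (normr_ge0 _) (normr_ge0 _) q2 cub_bound.
  lra.
have F0' := ler_wpM2r (normr_ge0 v0) F0; have F1' := ler_wpM2r (normr_ge0 v1) F1.
rewrite -!normrM in F0' F1'.
match type of F0' with is_true (`|?X| <= _) => set X0 := X in F0' end.
match type of F1' with is_true (`|?X| <= _) => set X1 := X in F1' end.
rewrite (_ : _ + _ = X0 + X1 + b * (Q * cub al be v0 v1 - Q' * cub al' be' v0 v1)); last first.
  rewrite /X0 /X1 -QE -QE' /element_form /mass /slope; field.
  have [/andP[t0 _] _ _ _] := A; rewrite D0 D0' !gt_eqF //.
apply: le_trans (ler_normD _ _) _; apply: le_trans (lerD (ler_normD _ _) qpart) _.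
have : C0 * e * `|v0| <= C0 * e * V by rewrite ler_wpM2l ?mulr_ge0 // lerDl.
have : C1 * e * `|v1| <= C1 * e * V by rewrite ler_wpM2l ?mulr_ge0 // lerDr.
lra.
Qed.

End Lipschitz.

(** The inverse of [1 + \sum_k 1 / t k] replaces a minimum and also covers an empty [K]. *)
Lemma finite_lower_bound (R : realType) (K : finType) (t : K -> R) :
  (forall k, 0 < t k) -> exists2 t0, 0 < t0 <= 1 & forall k, t0 <= t k.
Proof.
move=> t_gt0; pose S := \sum_k (t k)^-1.
have S0 : 0 <= S by apply: sumr_ge0 => k _; rewrite invr_ge0 ltW.
exists (1 + S)^-1 => [|k].
  by rewrite invr_gt0 invf_le1 ?lerDl ?S0 ?ltr_pwDl.
rewrite -[t k]invrK lef_pV2 ?posrE ?invr_gt0 ?ltr_pwDl //.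
rewrite /S (bigD1 k) //= addrCA lerDl addr_ge0 //.
by apply: sumr_ge0 => k' _; rewrite invr_ge0 ltW.
Qed.

(** * Solvability and uniqueness for the nodal system *)

Section System.
Variables (R : realType) (n : nat) (K : finType) (iL iR : K -> 'I_n).
Variables (h r0 p0 p1 a b : K -> R) (pr : K -> R -> R).
Variables (cub : K -> R -> R -> R -> R -> R) (P : 'M[R]_n).
Hypothesis cover : forall j, exists k, j = iL k \/ j = iR k.
Hypotheses (h_gt0 : forall k, 0 < h k) (r0_gt0 : forall k, 0 < r0 k).
Hypotheses (a_ge0 : forall k, 0 <= a k) (b_ge0 : forall k, 0 <= b k).
Hypothesis pr_ge0 : forall k r, 0 < r -> 0 <= pr k r.
Hypothesis pr_mono : forall k r r', 0 < r -> r <= r' -> pr k r <= pr k r'.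
Hypothesis pr_continuous : forall k r, 0 < r -> {for r, continuous (pr k)}.
Hypothesis cub_linear : forall k al be t v0 v1 w0 w1,
  cub k al be (t * v0 + w0) (t * v1 + w1) = t * cub k al be v0 v1 + cub k al be w0 w1.
Hypothesis cub_ge0 : forall k al be, 0 <= cub k al be al be.
Hypothesis cub0 : forall k v0 v1, cub k 0 0 v0 v1 = 0.
Hypothesis cub_lip : forall k al be al' be' v0 v1,
  `|cub k al be v0 v1 - cub k al' be' v0 v1| <=
  (`|al| + `|be| + `|al'| + `|be'|) * (`|al - al'| + `|be - be'|) * (`|v0| + `|v1|) * h k.
Hypothesis P_idem : P *m P = P.

Local Notation L y k := (y 0 (iL k)).
Local Notation Rt y k := (y 0 (iR k)).

(** The density is a separate argument, so that a truncated one can be inserted for [dens]. *)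
Definition form tau (rho : K -> R) (y v : 'rV[R]_n) : R :=
  \sum_k element_form (h k) (r0 k) (p0 k) (p1 k) (a k) (b k) tau (rho k) (pr k (rho k))
    (cub k (L y k) (Rt y k) (L v k) (Rt v k)) (L y k) (Rt y k) (L v k) (Rt v k).

Definition dens tau (y : 'rV[R]_n) (k : K) : R := density (h k) (r0 k) tau (L y k) (Rt y k).

Definition solution tau (y : 'rV[R]_n) : Prop :=
  [/\ y *m P = y, forall k, 0 < dens tau y k &
      forall v, v *m P = v -> form tau (dens tau y) y v = 0].

Lemma element_formD hh rr0 pp0 pp1 aa bb tau r p q q' al be t (v0 v1 w0 w1 : R) :
  element_form hh rr0 pp0 pp1 aa bb tau r p (t * q + q') al be (t * v0 + w0) (t * v1 + w1) =
  t * element_form hh rr0 pp0 pp1 aa bb tau r p q al be v0 v1 +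
  element_form hh rr0 pp0 pp1 aa bb tau r p q' al be w0 w1.
Proof. by rewrite /element_form /mass /slope; ring. Qed.

Lemma form_linear tau rho y t v w :
  form tau rho y (t *: v + w) = t * form tau rho y v + form tau rho y w.
Proof.
rewrite /form mulr_sumr -big_split; apply: eq_bigr => k _ /=.
by rewrite !mxE cub_linear element_formD.
Qed.

Definition truncated (d : K -> R) tau y k := Num.max (dens tau y k) (d k).

Lemma form_continuous d tau v : (forall k, 0 < d k) ->
  continuous (fun y => form tau (truncated d tau y) y v).
Proof.
move=> d0; apply: sumr_continuous => k.
have Lc : continuous (fun y : 'rV[R]_n => L y k) by move=> x; exact: coord_continuous.
have Rc : continuous (fun y : 'rV[R]_n => Rt y k) by move=> x; exact: coord_continuous.
have cc (c : R) : continuous (fun _ : 'rV[R]_n => c) by move=> x; exact: cst_continuous.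
have sc : continuous (fun y : 'rV[R]_n => slope (h k) (L y k) (Rt y k)).
  by apply: fcontM => //; apply: fcontB.
have tc : continuous (fun y : 'rV[R]_n => truncated d tau y k).
  by apply: fcont_max => //; apply: fcontB => //; apply: fcontM.
have t0 y : 0 < truncated d tau y k by rewrite lt_max d0 orbT.
have mc (p q v0 v1 : R) : continuous (fun y : 'rV[R]_n => mass (h k) (L y k - p) (Rt y k - q) v0 v1).
  by apply: fcontM => //; repeat apply: fcontD; repeat apply: fcontM => //; apply: fcontB.
have mc' : continuous (fun y : 'rV[R]_n => mass (h k) (L y k) (Rt y k) (L y k) (Rt y k)).
  by apply: fcontM => //; repeat apply: fcontD; repeat apply: fcontM => //.
have mc0 (v0 v1 : R) : continuous (fun y : 'rV[R]_n => mass (h k) (L y k) (Rt y k) v0 v1).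
  by apply: fcontM => //; repeat apply: fcontD; repeat apply: fcontM => //.
have ic : continuous (fun y : 'rV[R]_n => (truncated d tau y k ^+ 2)^-1).
  by apply: fcontV => [y|]; [rewrite gt_eqF // exprn_gt0|exact: fcontX].
have prc : continuous (fun y : 'rV[R]_n => pr k (truncated d tau y k)).
  by move=> y; apply: (continuous_comp (tc y)); exact: pr_continuous.
have cubc (v0 v1 : R) : continuous (fun y : 'rV[R]_n => cub k (L y k) (Rt y k) v0 v1).
  pose w (x y : 'rV[R]_n) := (`|L x k| + `|Rt x k| + `|L y k| + `|Rt y k|) *
    (`|L x k - L y k| + `|Rt x k - Rt y k|) * (`|v0| + `|v1|) * h k.
  apply: (@fcont_dominated _ _ _ w) => [x|x|x y].
  - apply: fcontM => //; apply: fcontM => //.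
    by apply: fcontM; repeat apply: fcontD; try apply: fcont_norm => //; apply: fcontB.
  - by rewrite /w !subrr normr0 addr0 mulr0 !mul0r.
  - exact: cub_lip.
rewrite /element_form; apply: fcontD; last by apply: fcontM => //; apply: fcontM.
apply: fcontD.
  apply: fcontB; first apply: fcontD.
  - by apply: fcontM.
  - by apply: fcontM => //; apply: fcontM.
  - apply: fcontM => //; apply: fcontM => //.
    under eq_fun do rewrite invfM; exact: fcontM.
apply: fcontM => //; apply: fcontM => //; apply: fcontB => //.
by apply: fcontM => //; apply: fcontM.
Qed.

(* The truncation of the density makes the system well defined everywhere. *)
Lemma truncated_solution d (c D : K -> R) tau : (forall k, 0 < d k) -> (forall k, 0 < c k) ->
  (forall (y : 'rV[R]_n) k, c k * (L y k ^+ 2 + Rt y k ^+ 2) - D k <=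
    element_form (h k) (r0 k) (p0 k) (p1 k) (a k) (b k) tau (truncated d tau y k)
      (pr k (truncated d tau y k)) (cub k (L y k) (Rt y k) (L y k) (Rt y k))
      (L y k) (Rt y k) (L y k) (Rt y k)) ->
  exists2 y, y *m P = y &
    forall v, v *m P = v -> form tau (truncated d tau y) y v = 0.
Proof.
move=> d0 c0 low.
pose F y v := form tau (truncated d tau y) y v.
have lowF (y : 'rV[R]_n) : \sum_k c k * (L y k ^+ 2 + Rt y k ^+ 2) - \sum_k D k <= F y y.
  by rewrite -sumrB; apply: ler_sum => k _; exact: low.
have S0 (y : 'rV[R]_n) k : 0 <= c k * (L y k ^+ 2 + Rt y k ^+ 2).
  by rewrite mulr_ge0 ?addr_ge0 ?sqr_ge0 // ltW.
(* The largest nodal value belongs to some element [k]; it is at least 1 and at least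
   [1 + |\sum D| / c k], so its square times [c k] exceeds the total defect. Summing over [k] serves
   all elements at once. *)
pose M : R := 1 + \sum_k `|\sum_k' D k'| / c k.
apply: (@zero_on_subspace R n P F P_idem _ _ M (\sum_k D k)).
- by move=> x t u v; exact: form_linear.
- by move=> v; exact: form_continuous.
- move=> y _; apply: le_trans (lowF y).
  by rewrite lerBrDr addNr; apply: sumr_ge0 => k _; exact: S0.
- move=> y _ yM; apply: lt_le_trans (lowF y); rewrite subr_gt0.
  have M1 : 1 <= M by rewrite /M lerDl; apply: sumr_ge0 => k _; rewrite divr_ge0 // ltW.
  have : `|y| != 0 by rewrite gt_eqF // (lt_le_trans _ yM) // (lt_le_trans ltr01 M1).
  move=> /(@mx_norm_neq0 R _ _ y)[[i j] /= e]; rewrite ord1 in e.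
  have {}e : `|y| = `|y 0 j| := e.
  have [k jk] := cover j.
  have le1 : c k * `|y 0 j| ^+ 2 <= \sum_k c k * (L y k ^+ 2 + Rt y k ^+ 2).
    rewrite (bigD1 k) //= real_normK ?num_real //.
    apply: (@le_trans _ _ (c k * (L y k ^+ 2 + Rt y k ^+ 2))).
      by rewrite ler_pM2l //; case: jk => ->; rewrite ?lerDl ?lerDr sqr_ge0.
    by rewrite lerDl; apply: sumr_ge0 => k' _; exact: S0.
  apply: lt_le_trans le1.
  have M2 : 1 + `|\sum_k' D k'| / c k <= `|y 0 j|.
    rewrite -e; apply: le_trans yM; rewrite /M lerD2l [leRHS](bigD1 k) //= lerDl.
    by apply: sumr_ge0 => k' _; rewrite divr_ge0 // ltW.
  have M3 : c k + `|\sum_k' D k'| <= c k * `|y 0 j|.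
    have -> : c k + `|\sum_k' D k'| = c k * (1 + `|\sum_k' D k'| / c k).
      by field; rewrite gt_eqF.
    by rewrite ler_pM2l.
  have M4 : 1 <= `|y 0 j| by rewrite -e; apply: le_trans yM.
  have M5 : c k * `|y 0 j| <= c k * `|y 0 j| ^+ 2.
    by rewrite ler_pM2l // expr2 ler_peMr.
  have := ler_norm (\sum_k' D k'); have := c0 k; lra.
Qed.

Lemma damped_solution tau : (forall k, 0 < a k) -> 0 < tau ->
  exists y, solution tau y.
Proof.
move=> a_gt0 tau0.
have h_ge0 k : 0 <= h k by exact: ltW.
have r0_ge0 k : 0 <= r0 k by exact: ltW.
have tau_ge0 := ltW tau0.
pose P0 k := pr k (r0 k).
have P00 k : 0 <= P0 k by exact: pr_ge0.
(* [E] is the loss allowed by the first bound of [dissipation_lower_bound]; [D] is the most by which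
   an element can lower the energy. *)
pose E k := P0 k * r0 k / tau * h k.
have E0 k : 0 <= E k by rewrite /E mulr_ge0 // divr_ge0 // mulr_ge0.
pose D k := mass (h k) (p0 k) (p1 k) (p0 k) (p1 k) / (2 * (tau * r0 k)) + E k.
have D0 k : 0 <= D k.
  by rewrite addr_ge0 // divr_ge0 ?mass_ge0 // !mulr_ge0.
have DS : 0 <= \sum_k D k by apply: sumr_ge0.
(* At this level of dissipation a single element gains the sum of all [D] plus 1, more than all
   elements together can lose. *)
pose Z k := P0 k + (\sum_k' D k' + 1) * (2 * tau / (h k * r0 k)).
have Z1 k : P0 k < Z k.
  by rewrite ltrDl mulr_gt0 ?ltr_wpDl // divr_gt0 ?mulr_gt0.
have Z0 k : 0 < Z k by apply: le_lt_trans (Z1 k).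
(* The first entry keeps elements of nonpositive slope untruncated; [d <= 1] gives [d ^ 2 <= d], so
   that the last entry yields [dZ]. *)
pose d k := Num.min (r0 k / 2) (Num.min 1 (a k * r0 k / (2 * tau * Z k))).
have d0 k : 0 < d k.
  by rewrite !lt_min ltr01 !divr_gt0 ?mulr_gt0.
have dr k : 2 * d k <= r0 k.
  have : d k <= r0 k / 2 by rewrite ge_min lexx.
  by lra.
have dZ k : Z k <= a k * r0 k / (2 * tau * d k ^+ 2).
  rewrite ler_pdivlMr ?mulr_gt0 ?exprn_gt0 //.
  have d1 : d k <= 1 by rewrite !ge_min lexx orbT.
  have : d k <= a k * r0 k / (2 * tau * Z k) by rewrite !ge_min lexx !orbT.
  rewrite ler_pdivlMr ?mulr_gt0 // => d2; apply: le_trans d2.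
  rewrite (_ : Z k * (2 * tau * d k ^+ 2) = (d k * (2 * tau * Z k)) * d k); last by ring.
  by rewrite ler_piMr // !mulr_ge0 // ltW.
have tr0 y k : 0 < truncated d tau y k by rewrite lt_max d0 orbT.
have slope_le (y : 'rV[R]_n) k : slope (h k) (L y k) (Rt y k) <= 0 -> truncated d tau y k = dens tau y k.
  move=> s0; apply/max_idPl; rewrite /dens /density; have := dr k; have := d0 k; nra.
have slope_gt (y : 'rV[R]_n) k : 0 < slope (h k) (L y k) (Rt y k) -> pr k (truncated d tau y k) <= P0 k.
  move=> s0; apply: pr_mono => //; rewrite ge_max /dens /density; apply/andP; split.
    by rewrite gerBl mulr_ge0 // ltW.
  by have := dr k; have := d0 k; lra.
have diss (y : 'rV[R]_n) k := @dissipation_lower_bound R (h k) (r0 k) (a k) tau (d k)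
  (pr k (truncated d tau y k)) (P0 k) (L y k) (Rt y k) (r0_gt0 k) tau0 (a_ge0 k) (d0 k)
  (dr k) (pr_ge0 k (tr0 y k)) (P00 k) (@slope_gt y k) (le_trans (ltW (Z1 k)) (dZ k)).
pose c k := 3 / (8 * (tau * r0 k)) * (h k / 6).
have c0 k : 0 < c k by rewrite mulr_gt0 ?divr_gt0 ?mulr_gt0.
have energy (y : 'rV[R]_n) k : c k * (L y k ^+ 2 + Rt y k ^+ 2) - (D k - E k)
    + (a k * slope (h k) (L y k) (Rt y k) ^+ 2 / (truncated d tau y k) ^+ 2
      - pr k (truncated d tau y k) * slope (h k) (L y k) (Rt y k)) * h k <=
  element_form (h k) (r0 k) (p0 k) (p1 k) (a k) (b k) tau (truncated d tau y k)
      (pr k (truncated d tau y k)) (cub k (L y k) (Rt y k) (L y k) (Rt y k))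
      (L y k) (Rt y k) (L y k) (Rt y k).
  apply: le_trans (element_energy _ _ _ _ (h_gt0 k) (r0_gt0 k) tau0 (b_ge0 k)
    (cub_ge0 _ _ _) (tr0 y k) (@slope_le y k)).
  rewrite lerD2r addrK lerD2r /c -mulrA; apply: ler_wpM2l.
    by rewrite divr_ge0 // !mulr_ge0 // ltW.
  by apply: mass_coercive; rewrite ltW.
have lower (y : 'rV[R]_n) k : c k * (L y k ^+ 2 + Rt y k ^+ 2) - D k <=
  element_form (h k) (r0 k) (p0 k) (p1 k) (a k) (b k) tau (truncated d tau y k)
      (pr k (truncated d tau y k)) (cub k (L y k) (Rt y k) (L y k) (Rt y k))
      (L y k) (Rt y k) (L y k) (Rt y k).
  apply: le_trans (energy y k); have [+ _] := diss y k.
  by move=> /(ler_wpM2r (h_ge0 k)); rewrite mulNr -/(E k); lra.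
have [y yP y0] := truncated_solution d0 c0 lower; exists y.
  (* An element where the truncation is active would make the form at [y], tested with [y],
     positive. *)
  have rE k : truncated d tau y k = dens tau y k.
    apply/max_idPl; rewrite leNgt; apply/negP => lt.
    have : form tau (truncated d tau y) y y = 0 by apply: y0.
    suff : 0 < form tau (truncated d tau y) y y by move=> /[swap] ->; rewrite ltxx.
    rewrite /form (bigD1 k) //=.
    have lowk := energy y k.
    have [_ /(_ lt) bigk] := diss y k.
    have Zk : \sum_k' D k' + 1 <= h k * (r0 k / (2 * tau) * (a k * r0 k / (2 * tau * d k ^+ 2) - P0 k)).
      have -> : \sum_k' D k' + 1 = h k * (r0 k / (2 * tau) * (Z k - P0 k)).
        by rewrite /Z; field; rewrite !gt_eqF.
      rewrite ler_pM2l // ler_pM2l ?divr_gt0 ?mulr_gt0 //.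
      by rewrite lerD2r.
    have {}bigk := ler_wpM2l (h_ge0 k) bigk.
    have rest : - \sum_(k' | k' != k) D k' <= \sum_(k' | k' != k)
       element_form (h k') (r0 k') (p0 k') (p1 k') (a k') (b k') tau (truncated d tau y k')
      (pr k' (truncated d tau y k')) (cub k' (L y k') (Rt y k') (L y k') (Rt y k'))
      (L y k') (Rt y k') (L y k') (Rt y k').
      rewrite -sumrN; apply: ler_sum => k' _; apply: le_trans (lower y k').
      by rewrite lerDr mulr_ge0 ?addr_ge0 ?sqr_ge0 // ltW.
    have := E0 k; have S0 : 0 <= c k * (L y k ^+ 2 + Rt y k ^+ 2).
      by rewrite mulr_ge0 ?addr_ge0 ?sqr_ge0 // ltW.
    have DE : \sum_k' D k' = D k + \sum_(k' | k' != k) D k' by rewrite (bigD1 k).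
    rewrite [h k * _ in X in _ <= X]mulrC in bigk.
    lra.
  have yE : dens tau y = truncated d tau y by apply/funext => k.
  by split => // [k|v vP]; [rewrite yE|rewrite yE y0].
Qed.

(** Constants of [element_energy_uniform]. None involves [tau], so the time step can be chosen after
    [bound], which rests on [|x| <= 1 + z] whenever [x ^ 2 <= z]. *)
Let young k := h k / (32 * r0 k).
Let defect k := mass (h k) (p0 k) (p1 k) (p0 k) (p1 k) / (2 * r0 k)
  + 16 * r0 k / h k * pr k (r0 k) ^+ 2.
Let bound k := 1 + \sum_k' defect k' / young k.

Let young_gt0 k : 0 < young k.
Proof. by rewrite divr_gt0 // mulr_gt0. Qed.

Let defect_ge0 k : 0 <= defect k.
Proof.
have := ltW (h_gt0 k) => h0; have := ltW (r0_gt0 k) => rr.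
apply: addr_ge0; first by rewrite divr_ge0 ?mass_ge0 // mulr_ge0.
by apply: mulr_ge0; [rewrite divr_ge0 // mulr_ge0|exact: sqr_ge0].
Qed.

Lemma form_lower_bound tau (rho : K -> R) (y : 'rV[R]_n) k : 0 < tau <= 1 -> 0 < rho k ->
  (slope (h k) (L y k) (Rt y k) <= 0 -> rho k = dens tau y k) ->
  (0 < slope (h k) (L y k) (Rt y k) -> rho k <= r0 k) ->
  young k * (L y k ^+ 2 + Rt y k ^+ 2) - defect k <=
  tau * element_form (h k) (r0 k) (p0 k) (p1 k) (a k) (b k) tau (rho k)
      (pr k (rho k)) (cub k (L y k) (Rt y k) (L y k) (Rt y k))
      (L y k) (Rt y k) (L y k) (Rt y k).
Proof.
move=> tau01 rho0 rhoE rhor; apply: element_energy_uniform => //.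
- exact: pr_ge0.
- by move=> s0; apply: pr_mono => //; exact: rhor.
- exact: pr_ge0.
Qed.

(** The hypotheses on [rho] fit both the truncated density and that of an arbitrary solution: one
    bound serves existence and uniqueness. *)
Lemma a_priori_bound tau (rho : K -> R) (y : 'rV[R]_n) : 0 < tau <= 1 ->
  (forall k, 0 < rho k) ->
  (forall k, slope (h k) (L y k) (Rt y k) <= 0 -> rho k = dens tau y k) ->
  (forall k, 0 < slope (h k) (L y k) (Rt y k) -> rho k <= r0 k) ->
  form tau rho y y = 0 -> forall k, `|L y k| <= bound k /\ `|Rt y k| <= bound k.
Proof.
move=> tau01 rho0 rhoE rhor f0 k.
have low k' := form_lower_bound tau01 (rho0 k') (rhoE k') (rhor k').
have : \sum_k' (young k' * (L y k' ^+ 2 + Rt y k' ^+ 2) - defect k') <= 0.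
  apply: (@le_trans _ _ (tau * form tau rho y y)); last by rewrite f0 mulr0.
  by rewrite /form mulr_sumr; apply: ler_sum => k' _; exact: low.
rewrite sumrB subr_le0 (bigD1 k) //= => le.
have S0 : 0 <= \sum_(k' | k' != k) young k' * (L y k' ^+ 2 + Rt y k' ^+ 2).
  by apply: sumr_ge0 => k' _; rewrite mulr_ge0 ?addr_ge0 ?sqr_ge0 // ltW.
have main : L y k ^+ 2 + Rt y k ^+ 2 <= \sum_k' defect k' / young k.
  by rewrite -mulr_suml ler_pdivlMr // mulrC; lra.
have sq_le (x z : R) : 0 <= z -> x ^+ 2 <= z -> `|x| <= 1 + z.
  by move=> z0; rewrite -(real_normK (num_real x)) => xz; nra.
have := sqr_ge0 (L y k); have := sqr_ge0 (Rt y k) => A1 A2.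
split; apply: sq_le; lra.
Qed.

(** The density is truncated at half of its old value, and the a priori bound makes this inactive.
    For uniqueness the difference of two solutions is the test function. *)
Lemma small_step_solution : exists2 tau0, 0 < tau0 & forall tau, 0 < tau <= tau0 ->
  exists2 y, solution tau y & forall y', solution tau y' -> y' = y.
Proof.
have lip k := element_form_lipschitz (bound k) (h_gt0 k) (r0_gt0 k) (a k) (p0 k) (p1 k)
  (b_ge0 k) (cub0 k) (cub_lip k).
have /choice[C CP] k : exists C, 0 <= C /\ (forall tau al be al' be' p p' v0 v1,
    admissible (h k) (r0 k) (bound k) tau al be ->
    admissible (h k) (r0 k) (bound k) tau al' be' ->
    `| element_form (h k) (r0 k) (p0 k) (p1 k) (a k) (b k) tau
         (density (h k) (r0 k) tau al be) p (cub k al be v0 v1) al be v0 v1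
     - element_form (h k) (r0 k) (p0 k) (p1 k) (a k) (b k) tau
         (density (h k) (r0 k) tau al' be') p' (cub k al' be' v0 v1) al' be' v0 v1
     - mass (h k) (al - al') (be - be') v0 v1 / (tau * r0 k) + (p - p') * slope (h k) v0 v1 * h k |
    <= C * (`|al - al'| + `|be - be'|) * (`|v0| + `|v1|)).
  by have [C C0 CP] := lip k; exists C.
have bound_gt0 k : 0 < bound k.
  by rewrite ltr_pwDl //; apply: sumr_ge0 => k' _; rewrite divr_ge0 // ltW.
(* The first bound makes [tau] times a slope at most [r0 / 2]. The second makes inertia at least
   [4 * (C + 1)] times the squared nodal differences, against at most [2 * C] from the Lipschitz
   terms. *)
have [|t0 /andP[t00 t01] tP] := @finite_lower_bound R K (fun k =>
   Num.min (r0 k * h k / (4 * bound k)) (h k / (24 * r0 k * (C k + 1)))).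
  move=> k; have [C0 _] := CP k.
  by rewrite lt_min !divr_gt0 ?mulr_gt0 // ltr_wpDl.
exists t0 => // tau /andP[tau0 taut].
have tau01 : 0 < tau <= 1 by rewrite tau0 (le_trans taut).
(* The a priori bound keeps the density above half of its previous value. *)
have dens_half (y : 'rV[R]_n) k : `|L y k| <= bound k /\ `|Rt y k| <= bound k ->
    r0 k / 2 <= dens tau y k.
  move=> [Lb Rb]; have : tau <= r0 k * h k / (4 * bound k).
    by apply: (le_trans taut); apply: (le_trans (tP k)); rewrite ge_min lexx.
  rewrite ler_pdivlMr ?mulr_gt0 // => tb.
  have sb : slope (h k) (L y k) (Rt y k) <= 2 * bound k / h k.
    rewrite ler_pM2r ?invr_gt0 //.
    by have := ler_norm (Rt y k); have := lerNnormlW (lexx `|L y k|); lra.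
  have : tau * slope (h k) (L y k) (Rt y k) <= r0 k / 2.
    apply: le_trans (ler_wpM2l (ltW tau0) sb) _.
    by rewrite mulrA ler_pdivrMr //; lra.
  by rewrite /dens /density; lra.
have dens_le (y : 'rV[R]_n) k : 0 < slope (h k) (L y k) (Rt y k) -> dens tau y k <= r0 k.
  by move=> s0; rewrite gerBl mulr_ge0 // ltW.
have d0 k : 0 < r0 k / 2 by rewrite divr_gt0.
have slope_le (y : 'rV[R]_n) k :
    slope (h k) (L y k) (Rt y k) <= 0 -> truncated (fun k => r0 k / 2) tau y k = dens tau y k.
  by move=> s0; apply/max_idPl; rewrite /dens /density; have := r0_gt0 k; nra.
have tr_le (y : 'rV[R]_n) k : 0 < slope (h k) (L y k) (Rt y k) ->
    truncated (fun k => r0 k / 2) tau y k <= r0 k.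
  by move=> s0; rewrite ge_max dens_le //=; have := r0_gt0 k; lra.
have tr0 y k : 0 < truncated (fun k => r0 k / 2) tau y k by rewrite lt_max d0 orbT.
have [||y yP y0] := @truncated_solution (fun k => r0 k / 2) (fun k => young k / tau)
   (fun k => defect k / tau) tau d0.
- by move=> k; rewrite divr_gt0.
- move=> y k.
  have := form_lower_bound tau01 (tr0 y k) (slope_le y k) (tr_le y k).
  rewrite -ler_pdivrMl //; apply: le_trans.
  by rewrite le_eqVlt; apply/orP; left; apply/eqP; field; rewrite gt_eqF.
have yb := a_priori_bound tau01 (tr0 y) (slope_le y) (tr_le y) (y0 _ yP).
have yE : truncated (fun k => r0 k / 2) tau y = dens tau y.
  by apply/funext => k; apply/max_idPl/dens_half.
have ysol : solution tau y.
  split => // [k|v vP]; last by rewrite -yE y0.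
  by rewrite -yE.
exists y => // y' [y'P dy' y'0].
have y'b := a_priori_bound tau01 dy' (fun k _ => erefl) (dens_le y') (y'0 _ y'P).
pose d := y - y'.
have dP : d *m P = d by rewrite mulmxBl yP y'P.
have f1 : form tau (dens tau y) y d = 0 by rewrite -yE y0.
have f2 := y'0 _ dP.
have gap k : L d k ^+ 2 + Rt d k ^+ 2 <=
   element_form (h k) (r0 k) (p0 k) (p1 k) (a k) (b k) tau (dens tau y k) (pr k (dens tau y k))
    (cub k (L y k) (Rt y k) (L d k) (Rt d k)) (L y k) (Rt y k) (L d k) (Rt d k) -
   element_form (h k) (r0 k) (p0 k) (p1 k) (a k) (b k) tau (dens tau y' k) (pr k (dens tau y' k))
    (cub k (L y' k) (Rt y' k) (L d k) (Rt d k)) (L y' k) (Rt y' k) (L d k) (Rt d k).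
  have [C0 {}CP] := CP k.
  have A : admissible (h k) (r0 k) (bound k) tau (L y k) (Rt y k).
    by have [] := yb k; split => //; apply: dens_half.
  have A' : admissible (h k) (r0 k) (bound k) tau (L y' k) (Rt y' k).
    by have [] := y'b k; split => //; apply: dens_half.
  have := CP _ _ _ _ _ (pr k (dens tau y k)) (pr k (dens tau y' k)) (L d k) (Rt d k) A A'.
  have Ld : L y k - L y' k = L d k by rewrite !mxE.
  have Rd : Rt y k - Rt y' k = Rt d k by rewrite !mxE.
  rewrite Ld Rd -/(dens tau y k) -/(dens tau y' k).
  set e1 := element_form _ _ _ _ _ _ _ (dens tau y k) _ _ _ _ _ _.
  set e2 := element_form _ _ _ _ _ _ _ _ _ _ _ _ _ _.
  (* The density decreases in the slope and the pressure increases with the density. *)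
  have mono : (pr k (dens tau y k) - pr k (dens tau y' k)) * slope (h k) (L d k) (Rt d k) * h k <= 0.
    have dE : dens tau y k - dens tau y' k = - (tau * slope (h k) (L d k) (Rt d k)).
      by rewrite -Ld -Rd /dens /density /slope; field; rewrite gt_eqF.
    have [s0|s0] := leP 0 (slope (h k) (L d k) (Rt d k)).
      rewrite mulr_le0_ge0 ?(ltW (h_gt0 k)) // mulr_le0_ge0 // subr_le0 pr_mono //.
        by rewrite -yE.
      by rewrite -subr_le0 dE oppr_le0 mulr_ge0 // ltW.
    rewrite mulr_le0_ge0 ?(ltW (h_gt0 k)) // mulr_ge0_le0 ?(ltW s0) // subr_ge0 pr_mono //.
    by rewrite -subr_ge0 dE oppr_ge0 mulr_ge0_le0 // ltW.
  rewrite ler_norml => /andP[low _].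
  have m1 := mass_coercive (L d k) (Rt d k) (ltW (h_gt0 k)).
  have tb : tau <= h k / (24 * r0 k * (C k + 1)).
    by apply: (le_trans taut); apply: (le_trans (tP k)); rewrite ge_min lexx orbT.
  have m2 : 4 * (C k + 1) * (L d k ^+ 2 + Rt d k ^+ 2) <=
      mass (h k) (L d k) (Rt d k) (L d k) (Rt d k) / (tau * r0 k).
    rewrite ler_pdivlMr ?mulr_gt0 //; apply: le_trans m1.
    rewrite mulrAC; apply: ler_wpM2r; first by rewrite addr_ge0 ?sqr_ge0.
    move: tb; rewrite ler_pdivlMr ?mulr_gt0 ?ltr_wpDl // => tb; lra.
  have e2b : (`|L d k| + `|Rt d k|) * (`|L d k| + `|Rt d k|) <= 2 * (L d k ^+ 2 + Rt d k ^+ 2).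
    rewrite -(real_normK (num_real (L d k))) -(real_normK (num_real (Rt d k))).
    by have := sqr_ge0 (`|L d k| - `|Rt d k|); nra.
  have := ler_wpM2l C0 e2b; rewrite mulrA.
  have := sqr_ge0 (L d k); have := sqr_ge0 (Rt d k); nra.
have sum0 : \sum_k (L d k ^+ 2 + Rt d k ^+ 2) <= 0.
  apply: (@le_trans _ _ (form tau (dens tau y) y d - form tau (dens tau y') y' d)).
    by rewrite /form -sumrB; apply: ler_sum => k _.
  by rewrite f1 f2 subrr.
have sq0 k : L d k ^+ 2 + Rt d k ^+ 2 = 0.
  have S0 k' : 0 <= L d k' ^+ 2 + Rt d k' ^+ 2 by rewrite addr_ge0 ?sqr_ge0.
  apply/eqP; rewrite eq_le S0 andbT; apply: le_trans sum0.
  by rewrite (bigD1 k) //= lerDl sumr_ge0.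
apply/eqP; rewrite eq_sym -subr_eq0 -/d; apply/eqP/rowP => j; rewrite [RHS]mxE.
have [k jk] := cover j; have /eqP := sq0 k.
rewrite paddr_eq0 ?sqr_ge0 // !sqrf_eq0 => /andP[/eqP h1 /eqP h2].
by case: jk => ->.
Qed.

End System.

(** * Integration on the elements of a mesh *)

Section AlmostEverywhereIntegral.
Import HBNNSimple.
Context d (T : measurableType d) (R : realType) (mu : {measure set T -> \bar R}).
Local Open Scope ereal_scope.

(** A simple function below [F], set to 0 on [N], keeps its integral and lies below [G]. *)
Lemma sup_sintegral_ae (N : set T) (F G : T -> \bar R) : measurable N -> mu N = 0 ->
  (forall x, ~ N x -> F x = G x) -> (forall x, 0 <= G x) ->
  ereal_sup [set sintegral mu h | h in [set h : {nnsfun T >-> R} | forall x, (h x)%:E <= F x]] <=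
  ereal_sup [set sintegral mu h | h in [set h : {nnsfun T >-> R} | forall x, (h x)%:E <= G x]].
Proof.
move=> mN N0 FG G0; apply: ge_ereal_sup => _ [h /= hF <-].
have E x : (proj_nnsfun h (measurableC mN) : T -> R) x = (h \_ (~` N)) x.
  by rewrite /proj_nnsfun /= mindicE patchE; case: ifP; rewrite ?mulr1 ?mulr0.
apply: ereal_sup_ubound; exists (proj_nnsfun h (measurableC mN)) => [x|].
  rewrite (E x) patchE; case: ifPn => [|_]; last exact: G0.
  by rewrite inE => xN; rewrite -FG.
rewrite -!integralT_nnsfun.
apply: ae_eq_integral => //.
  exact/measurable_EFinP.
  exact/measurable_EFinP.
exists N; split => // x /= /not_implyP[_]; apply: contra_notP => xN.
by congr EFin; rewrite [LHS]E patchE mem_set.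
Qed.

(* The integral is a supremum over simple functions, even if the integrand is
   not measurable. *)
Lemma ae_eq_integral_nonmeasurable (D : set T) (f g : T -> \bar R) :
  ae_eq mu D f g -> \int[mu]_(x in D) f x = \int[mu]_(x in D) g x.
Proof.
move=> [N [mN N0 fgN]].
have E x : ~ N x -> (f \_ D) x = (g \_ D) x.
  move=> xN; rewrite !patchE; case: ifPn => // xD.
  apply: contrapT => fg; apply: xN; apply: fgN => /=; apply/not_implyP.
  by split => //; exact: set_mem.
have Ep x : ~ N x -> (f \_ D)^\+ x = (g \_ D)^\+ x by move=> /E; rewrite !funeposE => ->.
have En x : ~ N x -> (f \_ D)^\- x = (g \_ D)^\- x by move=> /E; rewrite !funenegE => ->.
rewrite /integral; congr (_ - _); apply/eqP; rewrite eq_le; apply/andP;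
  by split; apply: (@sup_sintegral_ae N) => // x xN; rewrite ?Ep ?En.
Qed.

End AlmostEverywhereIntegral.

Lemma ae_eq_Rintegral d (T : measurableType d) (R : realType) (mu : {measure set T -> \bar R})
  (D : set T) (f g : T -> R) :
  f = g %[ae mu in D] -> \int[mu]_(x in D) f x = \int[mu]_(x in D) g x.
Proof.
move=> fg; congr fine; apply: ae_eq_integral_nonmeasurable.
by apply: filterS fg => x /= fgx /fgx ->.
Qed.

Section Interval.
Variable R : realType.
Local Notation mu := (@lebesgue_measure R).

Lemma continuous_integrable_itv (a b : R) (f : R -> R) :
  continuous f -> mu.-integrable `[a, b] (EFin \o f).
Proof.
move=> fc; apply: continuous_compact_integrable; first exact: segment_compact.
exact: continuous_subspaceT.
Qed.

Lemma Rintegral_sum (I : finType) (D : set R) (F : I -> R -> R) : measurable D ->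
  (forall i, mu.-integrable D (EFin \o F i)) ->
  \int[mu]_(x in D) (\sum_i F i x) = \sum_i \int[mu]_(x in D) F i x.
Proof.
move=> mD iF; suff [//] : \int[mu]_(x in D) (\sum_i F i x) = \sum_i \int[mu]_(x in D) F i x
  /\ mu.-integrable D (EFin \o (fun x => \sum_i F i x)).
elim: (index_enum I) => [|i s [IH1 IH2]].
  rewrite big_nil; under eq_Rintegral do rewrite big_nil.
  rewrite Rintegral_cst // mul0r; split => //.
  by under eq_fun do rewrite big_nil; exact: integrable0.
split.
  rewrite big_cons -IH1 -RintegralD //.
  by apply: eq_Rintegral => x _; rewrite big_cons.
have : mu.-integrable D ((EFin \o F i) \+ (EFin \o (fun x => \sum_(i <- s) F i x))) by exact: integrableD.
apply: eq_integrable => // x _ /=.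
by rewrite big_cons.
Qed.

Lemma L2_integrable (l : R) (g : R -> R) : L2 l g -> mu.-integrable `[0, l] (EFin \o g).
Proof.
move=> [mg ig].
have i1 : mu.-integrable `[0, l] (EFin \o (fun x => 1 + g x ^+ 2)).
  have : mu.-integrable `[0, l] ((EFin \o cst 1) \+ (fun x => (g x ^+ 2)%:E)).
    apply: integrableD => //; apply: continuous_integrable_itv; exact: cst_continuous.
  by apply: eq_integrable.
apply: le_integrable i1 => //; first exact/measurable_EFinP.
move=> x _ /=; rewrite lee_fin [leRHS]ger0_norm; last by rewrite addr_ge0 // sqr_ge0.
by rewrite -(real_normK (num_real (g x))); have := sqr_ge0 (`|g x| - 1); have := normr_ge0 (g x); nra.
Qed.

Lemma H1_continuous (l : R) (f : R -> R) : 0 <= l -> H1 l f -> {within `[0, l], continuous f}.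
Proof.
move=> l0 [g gL2 fE].
have := parameterized_integral_continuous l0 (L2_integrable gL2).
move=> gc; pose F x := f 0 + parameterized_integral mu 0 x g.
apply: (@subspace_eq_continuous _ _ _ F) => [x xl|].
  by apply/esym/fE; move: xl; rewrite inE.
by move=> x; apply: (@cvgD R R^o); [exact: cvg_cst|exact: gc].
Qed.

(** Around a point of difference the functions differ on a subinterval of positive length, which is
    not null. *)
Lemma ae_eq_within_continuous (a b : R) (f g : R -> R) : a < b ->
  {within `[a, b], continuous f} -> {within `[a, b], continuous g} ->
  f = g %[ae mu in `[a, b]%classic] -> forall x, x \in `[a, b] -> f x = g x.
Proof.
move=> ab fc gc [N [mN N0 fgN]] x xab.
have dc : {within `[a, b], continuous (f - g)}.
  by move=> y; apply: (@cvgB R R^o); [exact: fc|exact: gc].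
apply/eqP; rewrite -subr_eq0; apply: contraT => dx.
have e0 : 0 < `|f x - g x| by rewrite normr_gt0.
move/subspace_continuousP/(_ x xab)/cvgrPdist_lt/(_ _ e0) : dc.
move=> [r /= r0 rP].
pose u := Num.max a (x - r / 2); pose v := Num.min b (x + r / 2).
have uv : u < v.
  have /andP[ax xb] : a <= x <= b by move: xab; rewrite in_itv.
  by rewrite gt_max !lt_min ab /=; apply/andP; split; [lra|apply/andP; split; lra].
have sub : `[u, v] `<=` N.
  move=> y /=; rewrite in_itv /= ge_max le_min => /andP[/andP[ay xy] /andP[yb yx]].
  apply: fgN => /=; rewrite not_implyE; split; first by rewrite in_itv /= ay.
  move=> fg; have : `|(f x - g x) - (f y - g y)| < `|f x - g x|.
    apply: (rP y) => /=; last by rewrite in_itv /= ay.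
    by rewrite ltr_norml; apply/andP; split; lra.
  by rewrite fg subrr subr0 ltxx.
have : (mu `[u, v] <= mu N)%E by apply: le_measure => //; rewrite inE.
rewrite N0 lebesgue_measure_itv /= lte_fin uv -EFinB lee_fin subr_le0.
by rewrite leNgt uv.
Qed.

End Interval.

(** * Affine functions and the friction integral on one element *)

Section Affine.
Variables (R : realType) (a h : R).
Hypothesis h_gt0 : 0 < h.
Local Notation mu := (@lebesgue_measure R).

(* The affine function with values [al] at [a] and [be] at [a + h]. *)
Definition affine (al be x : R) : R := al + slope h al be * (x - a).

Lemma affine_continuous al be : continuous (affine al be).
Proof.
have cc (c : R) : continuous (fun _ : R => c) by move=> x; exact: cst_continuous.
have ic : continuous (fun x : R => x) by move=> x; exact.
by apply: fcontD => //; apply: fcontM => //; apply: fcontB.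
Qed.

Lemma affine_left al be : affine al be a = al.
Proof. by rewrite /affine subrr mulr0 addr0. Qed.

Lemma affine_right al be : affine al be (a + h) = be.
Proof. by rewrite /affine /slope; field; rewrite gt_eqF. Qed.

Lemma affine_bound al be x : x \in `[a, a + h] -> `|affine al be x| <= `|al| + `|be|.
Proof.
rewrite in_itv /= => /andP[ax xb]; pose t := (x - a) / h.
have t0 : 0 <= t by rewrite divr_ge0 ?subr_ge0 // ltW.
have t1 : t <= 1 by rewrite ler_pdivrMr // mul1r; lra.
have -> : affine al be x = (1 - t) * al + t * be.
  by rewrite /affine /slope /t; field; rewrite gt_eqF.
rewrite (le_trans (ler_normD _ _)) // [`|_ * al|]normrM [`|_ * be|]normrM lerD //.
  by rewrite ger0_norm ?subr_ge0 // ler_piMl // gerBl.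
by rewrite (ger0_norm t0) ler_piMl.
Qed.

Lemma affine_linear t al be al' be' x :
  affine (t * al + al') (t * be + be') x = t * affine al be x + affine al' be' x.
Proof. by rewrite /affine /slope; ring. Qed.

Lemma affineB al be al' be' x :
  affine al be x - affine al' be' x = affine (al - al') (be - be') x.
Proof. by rewrite /affine /slope; ring. Qed.

Lemma integral_affineM al be v0 v1 :
  \int[mu]_(x in `[a, a + h]) (affine al be x * affine v0 v1 x) = mass h al be v0 v1.
Proof.
have ab : a < a + h by rewrite ltrDl.
pose s := slope h al be; pose t := slope h v0 v1; pose Y : {poly R} := 'X - a%:P.
pose F : {poly R} := (al * v0) *: Y + ((al * t + s * v0) / 2) *: Y ^+ 2 + (s * t / 3) *: Y ^+ 3.
rewrite /Rintegral (@continuous_FTC2 _ _ (horner F)) //.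
- rewrite -EFinB /= /F /Y !hornerE /= /s /t /mass /slope; field; rewrite gt_eqF //.
- by apply: continuous_subspaceT; apply: fcontM; exact: affine_continuous.
- split; first by move=> x _; exact: derivable_horner.
    by apply: cvg_at_right_filter; exact: continuous_horner.
  by apply: cvg_at_left_filter; exact: continuous_horner.
- move=> x _; rewrite /affine -/s -/t -derive.derivE /F /Y; clearbody s t.
  rewrite !(derivD, derivZ, deriv_exp, derivB, derivN, derivX, derivC, oppr0, addr0, mul1r).
  by rewrite !hornerE /= ?expr1; field.
Qed.

Definition cubic (al be v0 v1 : R) : R :=
  \int[mu]_(x in `[a, a + h]) (`|affine al be x| * affine al be x * affine v0 v1 x).

Let cubic_continuous al be v0 v1 :
  continuous (fun x => `|affine al be x| * affine al be x * affine v0 v1 x).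
Proof.
by apply: fcontM; [apply: fcontM; [apply: fcont_norm|]|]; exact: affine_continuous.
Qed.

Lemma cubic_linear al be t v0 v1 w0 w1 :
  cubic al be (t * v0 + w0) (t * v1 + w1) = t * cubic al be v0 v1 + cubic al be w0 w1.
Proof.
have cc (c : R) : continuous (fun _ : R => c) by move=> x; exact: cst_continuous.
rewrite /cubic -RintegralZl ?continuous_integrable_itv // -RintegralD ?continuous_integrable_itv //.
  by apply: eq_Rintegral => x _; rewrite affine_linear; ring.
by apply: fcontM.
Qed.

Lemma cubic_ge0 al be : 0 <= cubic al be al be.
Proof.
by apply: Rintegral_ge0 => x _; rewrite -mulrA -expr2 mulr_ge0 // sqr_ge0.
Qed.

Lemma cubic0 v0 v1 : cubic 0 0 v0 v1 = 0.
Proof.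
rewrite /cubic (_ : (fun x => _) = cst 0) ?Rintegral_cst ?mul0r //.
by apply/funext => x; rewrite /affine /slope subrr !mul0r addr0 mulr0 mul0r.
Qed.

Lemma cubic_lip al be al' be' v0 v1 :
  `|cubic al be v0 v1 - cubic al' be' v0 v1| <=
  (`|al| + `|be| + `|al'| + `|be'|) * (`|al - al'| + `|be - be'|) * (`|v0| + `|v1|) * h.
Proof.
rewrite /cubic -RintegralB ?continuous_integrable_itv //.
set K := (X in _ <= X * h).
have mE : fine (mu `[a, a + h]) = h.
  by rewrite lebesgue_measure_itv /= lte_fin ltrDl h_gt0 -EFinB /= addrAC subrr add0r.
apply: (le_trans (le_normr_Rintegral _ _)) => //.
  by apply: continuous_integrable_itv; apply: fcontB.
rewrite -[X in K * X]mE -Rintegral_cst //; apply: le_Rintegral => //.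
- by apply: continuous_integrable_itv; apply: fcont_norm; apply: fcontB.
- by apply: continuous_integrable_itv => x; exact: cst_continuous.
move=> x xab; rewrite -mulrBl normrM.
have m1 := affine_bound al be xab; have m2 := affine_bound al' be' xab.
have m3 := affine_bound (al - al') (be - be') xab; have m4 := affine_bound v0 v1 xab.
apply: ler_pM => //.
set m := affine al be x in m1 *; set m' := affine al' be' x in m2 *.
rewrite -affineB -/m -/m' in m3.
have -> : `|m| * m - `|m'| * m' = `|m| * (m - m') + (`|m| - `|m'|) * m' by ring.
rewrite (le_trans (ler_normD _ _)) // !normrM normr_id.
have m5 := ler_dist_dist m m'; have m6 := le_trans m5 m3.
have := ler_pM (normr_ge0 _) (normr_ge0 _) m1 m3.
have := ler_pM (normr_ge0 _) (normr_ge0 _) m6 m2.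
lra.
Qed.

End Affine.

(** * The pressure law *)

Section Pressure.
Variables (R : realType) (G : network R) (c : edge G -> R) (gamma : R) (e : edge G).
Hypotheses (c_gt0 : 0 < c e) (gamma_gt1 : 1 < gamma).

Definition pressure (r : R) : R := derive1 (pot c gamma e) r.

Lemma pressureE r : 0 < r -> pressure r = c e / (gamma - 1) * (gamma * r `^ (gamma - 1)).
Proof.
move=> r0; rewrite /pressure derive1E.
have := is_derive1_powR gamma r0; set d := gamma * _ => dp.
have : is_derive r 1 (fun x => c e / (gamma - 1) * x `^ gamma) (c e / (gamma - 1) * d).
  exact: is_deriveZ.
by move=> [_ <-].
Qed.

Lemma pressure_ge0 r : 0 < r -> 0 <= pressure r.
Proof.
move=> r0; have g0 : 0 <= gamma := ltW (lt_trans ltr01 gamma_gt1).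
rewrite pressureE // mulr_ge0 //; last by rewrite mulr_ge0 ?powR_ge0.
by rewrite divr_ge0 ?subr_ge0 ?ltW.
Qed.

Lemma pressure_mono r r' : 0 < r -> r <= r' -> pressure r <= pressure r'.
Proof.
move=> r0 rr'; have r'0 := lt_le_trans r0 rr'.
have g0 : 0 <= gamma := ltW (lt_trans ltr01 gamma_gt1).
have g1 : 0 <= gamma - 1 by rewrite subr_ge0 ltW.
rewrite !pressureE //; apply: ler_wpM2l; first by rewrite divr_ge0 // ltW.
by apply: ler_wpM2l => //; apply: ge0_ler_powR => //; rewrite nnegrE ltW.
Qed.

Lemma pressure_continuous r : 0 < r -> {for r, continuous pressure}.
Proof.
move=> r0.
have pc : {for r, continuous (fun x => c e / (gamma - 1) * (gamma * x `^ (gamma - 1)))}.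
  apply: continuousM; first exact: cst_continuous.
  apply: continuousM; first exact: cst_continuous.
  apply: differentiable_continuous; apply/derivable1_diffP.
  by apply: derivable_powR; rewrite in_itv /= andbT.
rewrite /prop_for /continuous_at pressureE //; apply: cvg_trans pc.
apply: near_eq_cvg; near=> x; rewrite pressureE //.
by near: x; exact: lt_nbhsr.
Unshelve. all: by end_near. Qed.

End Pressure.

(** * The uniform mesh of an edge *)

Section Mesh.
Variables (R : realType) (G : network R) (N : edge G -> nat) (e : edge G).
Hypothesis N_gt0 : (0 < N e)%N.
Local Notation mu := (@lebesgue_measure R).

Definition width : R := len e / (N e)%:R.

Lemma len_gt0 : 0 < len e.
Proof. exact: elen_gt0. Qed.

Lemma width_gt0 : 0 < width.
Proof. by rewrite divr_gt0 ?len_gt0 // ltr0n. Qed.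

Lemma nodeE i : node N e i = i%:R * width.
Proof. by rewrite /node /width mulrA. Qed.

Lemma nodeS i : node N e i.+1 = node N e i + width.
Proof. by rewrite !nodeE -natr1 mulrDl mul1r. Qed.

Lemma node0 : node N e 0 = 0.
Proof. by rewrite nodeE mul0r. Qed.

Lemma node_last : node N e (N e) = len e.
Proof. by rewrite /node mulrAC mulfV ?mul1r // pnatr_eq0 -lt0n. Qed.

Lemma node_le i j : (i <= j)%N -> node N e i <= node N e j.
Proof. by move=> ij; rewrite !nodeE ler_pM2r ?width_gt0 // ler_nat. Qed.

Lemma elementE i : element N e i = `[node N e i, node N e i + width]%classic.
Proof. by rewrite /element nodeS. Qed.

Lemma element_sub (i : 'I_(N e)) : element N e i `<=` eint e.
Proof.
move=> x; rewrite /element /eint /= !in_itv /= => /andP[xa xb].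
rewrite (le_trans _ xa) /= -?node0 ?node_le // -node_last (le_trans xb) // node_le //.
Qed.

Lemma element_half_open x : 0 <= x < len e ->
  exists i : 'I_(N e), node N e i <= x < node N e i.+1.
Proof.
rewrite -node_last => /andP[x0 xl].
have : exists2 i, (i < N e)%N & node N e i <= x < node N e i.+1.
  elim: (N e) xl => [|k IH xl]; first by rewrite node0 ltNge x0.
  have [xk|xk] := ltP x (node N e k).
    by have [i ik ix] := IH xk; exists i => //; rewrite (ltn_trans ik).
  by exists k => //; rewrite xk.
by move=> [i iN ix]; exists (Ordinal iN).
Qed.

Lemma element_cover x : eint e x -> exists i : 'I_(N e), element N e i x.
Proof.
rewrite /eint /= in_itv /= => /andP[x0]; rewrite le_eqVlt => /orP[/eqP->|xl].
  have lt : ((N e).-1 < N e)%N by rewrite prednK.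
  exists (Ordinal lt); rewrite /element /= in_itv /= prednK //.
  by rewrite -[X in X <= _ <= _]/(node N e _) -node_last lexx andbT node_le // leq_pred.
have [|i /andP[ix xi]] := @element_half_open x; first by rewrite x0.
by exists i; rewrite /element /= in_itv /= ix ltW.
Qed.

Let ae_mu_filter : Filter (nbhs (almost_everywhere mu)).
Proof. exact: (ae_filter_ringOfSetsType mu). Qed.

Lemma ae_eint (P : R -> Prop) :
  (forall i : 'I_(N e), \forall x \ae mu, element N e i x -> P x) ->
  \forall x \ae mu, eint e x -> P x.
Proof.
move=> aeP; have : \forall x \ae mu, forall i : 'I_(N e), element N e i x -> P x.
  exact: (@filter_forall _ _ _ _ ae_mu_filter).
by apply: (@filterS _ _ ae_mu_filter) => x xP /element_cover[i]; exact: xP.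
Qed.

Lemma ae_neq (a : R) : \forall x \ae mu, x != a.
Proof.
exists [set a]; split => //; first exact: lebesgue_measure_set1.
by move=> x /= /negP; rewrite negbK => /eqP.
Qed.

(** The half-open cells [A i] are disjoint and miss only the point [len e], so [f] is almost
    everywhere the sum of the restrictions [J i], whose integrability is known. *)
Lemma Rintegral_eint (f : R -> R) (phi : 'I_(N e) -> R -> R) :
  (forall i, continuous (phi i)) ->
  (forall i : 'I_(N e), f = phi i %[ae mu in element N e i]) ->
  \int[mu]_(x in eint e) f x = \sum_(i < N e) \int[mu]_(x in element N e i) phi i x.
Proof.
move=> phic fphi.
pose A (i : 'I_(N e)) : set R := [set` `[node N e i, node N e i.+1[].
pose J i := phi i \_ (A i).
have iphi (i : 'I_(N e)) (S : set R) : S `<=` element N e i -> measurable S ->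
    mu.-integrable S (EFin \o phi i).
  move=> SE mS; have base : mu.-integrable (element N e i) (EFin \o phi i).
    exact: continuous_integrable_itv.
  by apply: integrableS base => //; exact: measurable_itv.
have Asub i : A i `<=` element N e i.
  by apply: subset_itvl; rewrite bnd_simp.
have Asub' i : A i `<=` eint e by move=> x /Asub; exact: element_sub.
have -> : \int[mu]_(x in eint e) f x = \int[mu]_(x in eint e) (\sum_i J i x).
  apply: ae_eq_Rintegral.
  have : \forall x \ae mu, (forall i : 'I_(N e), element N e i x -> f x = phi i x) /\ x != len e.
    apply: (@filterI _ _ ae_mu_filter); last exact: ae_neq.
    exact: (@filter_forall _ _ _ _ ae_mu_filter).
  apply: (@filterS _ _ ae_mu_filter) => x [fx xl]; rewrite /eint /= in_itv /= => /andP[x0 xle].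
  have [|i ix] := @element_half_open x; first by rewrite x0 lt_neqAle xl.
  rewrite (bigD1 i) //= big1 => [|j ji].
    have Aix : A i x by rewrite /A /= in_itv.
    by rewrite addr0 /J patchE mem_set //; apply/fx/Asub.
  rewrite /J patchE memNset //; rewrite /A /= in_itv /= => /andP[h1 h2].
  case/andP: ix => h3 h4; move: ji; rewrite -val_eqE neq_ltn => /orP[lt|lt].
    by have := lt_le_trans h2 (le_trans (node_le lt) h3); rewrite ltxx.
  by have := lt_le_trans h4 (le_trans (node_le lt) h1); rewrite ltxx.
rewrite Rintegral_sum; [|exact: measurable_itv|]; last first.
  move=> i; rewrite /J -restrict_EFin.
  apply/integrable_restrict; [exact: measurable_itv|exact: measurable_itv|].
  by rewrite setIidr; [apply: iphi => //; exact: measurable_itv|exact: Asub'].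
apply: eq_bigr => i _; rewrite /J -Rintegral_mkcondr setIidr; last exact: Asub'.
by rewrite Rintegral_itv_bndo_bndc //; apply: iphi; [exact: Asub|exact: measurable_itv].
Qed.

End Mesh.

(** * Piecewise affine and piecewise constant functions on an edge *)

Section EdgeFunctions.
Variables (R : realType) (G : network R) (N : edge G -> nat) (e : edge G).
Hypothesis N_gt0 : (0 < N e)%N.
Local Notation mu := (@lebesgue_measure R).
Local Notation w := (width N e).
Local Notation aff i := (affine (node N e i) w).

Let ae_mu_filter : Filter (nbhs (almost_everywhere mu)).
Proof. exact: (ae_filter_ringOfSetsType mu). Qed.

Definition piecewise_affine (f : R -> R) : Prop :=
  forall (i : 'I_(N e)) x, element N e i x ->
    f x = aff i (f (node N e i)) (f (node N e i.+1)) x.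

Lemma node_lt i : node N e i < node N e i.+1.
Proof. by rewrite nodeS ltrDl width_gt0. Qed.

Lemma element_nodeL i : element N e i (node N e i).
Proof. by rewrite /element /= in_itv /= lexx ltW ?node_lt. Qed.

Lemma element_nodeR i : element N e i (node N e i.+1).
Proof. by rewrite /element /= in_itv /= lexx ltW ?node_lt. Qed.

(** Continuity of [f] turns the almost everywhere equality with a polynomial into equality at every
    point, the nodes included. *)
Lemma H1_piecewise_affine (f : R -> R) : H1 (len e) f ->
  (forall i : 'I_(N e), exists2 p : {poly R}, (size p <= 2)%N &
     f = horner p %[ae mu in element N e i]) ->
  piecewise_affine f.
Proof.
move=> fH1 fp i x ix; have [p sp fE] := fp i.
have fc := continuous_subspaceW (@element_sub R G N e N_gt0 i) (H1_continuous (ltW (len_gt0 e)) fH1).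
have E y : element N e i y -> f y = p`_0 + p`_1 * y.
  move=> iy; have -> : p`_0 + p`_1 * y = p.[y].
    by rewrite (horner_coef_wide _ sp) !big_ord_recl big_ord0 /= expr0 expr1 mulr1 addr0.
  apply: (ae_eq_within_continuous (node_lt i)) => //.
  by apply: continuous_subspaceT; exact: continuous_horner.
rewrite !E //; [|exact: element_nodeR|exact: element_nodeL].
by rewrite /affine /slope nodeS; field; rewrite gt_eqF ?width_gt0.
Qed.

Lemma ae_element (i : 'I_(N e)) (P : R -> Prop) :
  (forall x, node N e i < x < node N e i.+1 -> P x) ->
  \forall x \ae mu, element N e i x -> P x.
Proof.
move=> H; apply: (@filterS2 _ _ ae_mu_filter _ _ _ _ (ae_neq (node N e i)) (ae_neq (node N e i.+1))).
move=> x xa xb; rewrite /element /= in_itv /= => /andP[ax bx]; apply: H.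
by rewrite !lt_neqAle ax bx xb eq_sym xa.
Qed.

(** The nodes, where [f] may have a kink, are null; near any other point of the element [f] is
    affine. *)
Lemma derive_piecewise_affine (f : R -> R) (i : 'I_(N e)) : piecewise_affine f ->
  derive1 f = cst (slope w (f (node N e i)) (f (node N e i.+1))) %[ae mu in element N e i].
Proof.
move=> fE; apply: ae_element => x /andP[ax xb]; rewrite derive1E /cst.
set al := f (node N e i); set be := f (node N e i.+1).
have : is_derive x 1 (aff i al be) (slope w al be).
  have -> : aff i al be = horner (al%:P + slope w al be *: ('X - (node N e i)%:P)).
    by apply/funext => y; rewrite !hornerE.
  have := is_derive_poly (al%:P + slope w al be *: ('X - (node N e i)%:P)) x.
  by rewrite !(derivD, derivN, derivZ, derivX, derivC, oppr0, addr0, add0r) hornerZ hornerC mulr1.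
move=> [_ <-]; apply: near_eq_derive; near=> y; rewrite (fE i) //.
rewrite /element /= in_itv /=; apply/andP; split; apply: ltW; near: y.
- exact: lt_nbhsr.
- exact: lt_nbhsl.
Unshelve. all: by end_near. Qed.

(** Half-open cells make the pieces disjoint; the value at [len e] is 0, which almost everywhere
    equality ignores. *)
Definition step (r : 'I_(N e) -> R) : R -> R :=
  fun x => \sum_(i < N e) (cst (r i) \_ [set` `[node N e i, node N e i.+1[]) x.

Lemma stepE (r : 'I_(N e) -> R) (i : 'I_(N e)) x :
  node N e i <= x < node N e i.+1 -> step r x = r i.
Proof.
move=> ix; rewrite /step (bigD1 i) //= big1 => [|j ji].
  have Ax : [set` `[node N e i, node N e i.+1[] x by rewrite /= in_itv.
  by rewrite addr0 patchE mem_set.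
rewrite patchE memNset //= in_itv /= => /andP[h1 h2].
case/andP: ix => h3 h4; move: ji; rewrite -val_eqE neq_ltn => /orP[lt|lt].
  by have := lt_le_trans h2 (le_trans (node_le N_gt0 lt) h3); rewrite ltxx.
by have := lt_le_trans h4 (le_trans (node_le N_gt0 lt) h1); rewrite ltxx.
Qed.

Lemma step_ae (r : 'I_(N e) -> R) (i : 'I_(N e)) :
  step r = cst (r i) %[ae mu in element N e i].
Proof. by apply: ae_element => x /andP[ax xb]; rewrite (stepE _ (i := i)) // ltW. Qed.

Lemma step_L2 (r : 'I_(N e) -> R) : L2 (len e) (step r).
Proof.
have ms : measurable_fun `[0, len e] (step r).
  rewrite /step; apply: measurable_sum => i; apply/measurable_restrict => //; exact: measurable_cst.
split=> //.
have i1 : mu.-integrable `[0, len e] (EFin \o cst ((\sum_i `|r i|) ^+ 2)).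
  by apply: continuous_integrable_itv => x; exact: cst_continuous.
apply: le_integrable i1 => //.
- by apply/measurable_EFinP; exact: measurable_funX.
- move=> x _ /=; rewrite lee_fin !ger0_norm ?sqr_ge0 //.
  rewrite -(real_normK (num_real (step r x))) lerXn2r ?nnegrE ?sumr_ge0 //.
  rewrite /step (le_trans (ler_norm_sum _ _ _)) //; apply: ler_sum => i _.
  by rewrite patchE; case: ifP => _ //; rewrite normr0.
Qed.

(** Piecewise affine interpolation is the primitive of its slopes; this puts the interpolant in [H1]
    by construction. *)
Lemma step_primitive (Y : nat -> R) (i : 'I_(N e)) x : element N e i x ->
  \int[mu]_(t in `[0, x]) step (fun j : 'I_(N e) => slope w (Y j) (Y j.+1)) t =
  aff i (Y i) (Y i.+1) x - Y 0%N.
Proof.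
set g := step _; have ig : mu.-integrable `[0, len e] (EFin \o g) by exact/L2_integrable/step_L2.
have piece (j : 'I_(N e)) y : element N e j y ->
    \int[mu]_(t in `[0, y]) g t = \int[mu]_(t in `[0, node N e j]) g t
      + slope w (Y j) (Y j.+1) * (y - node N e j).
  rewrite /element /= in_itv /= => /andP[jy yj].
  have yl : y <= len e by rewrite (le_trans yj) // -(node_last N_gt0) node_le.
  have igy : mu.-integrable `[0, y] (EFin \o g).
    apply: integrableS ig; [exact: measurable_itv|exact: measurable_itv|].
    by apply: subset_itvl; rewrite bnd_simp.
  have := @Rintegral_itvB R g (BLeft 0) (BRight y) (node N e j) igy.
  rewrite !bnd_simp => /(_ _ jy); rewrite -[X in X <= _](node0 N e) node_le // => /(_ isT) /eqP.
  rewrite subr_eq addrC => /eqP ->; congr (_ + _).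
  transitivity (\int[mu]_(t in `]node N e j, y]) cst (slope w (Y j) (Y j.+1)) t).
    apply: ae_eq_Rintegral.
    apply: (@filterS _ _ ae_mu_filter) (step_ae (fun j : 'I_(N e) => slope w (Y j) (Y j.+1)) j).
    move=> t tE; rewrite /= in_itv /= => /andP[jt ty]; apply: tE.
    by rewrite /element /= in_itv /= (ltW jt) (le_trans ty).
  rewrite Rintegral_cst; last exact: measurable_itv.
  have mE : fine (mu `]node N e j, y]) = y - node N e j.
    rewrite lebesgue_measure_itv /= lte_fin; case: ltP => [lt|ge]; first by rewrite -EFinB.
    by rewrite (_ : y = node N e j) ?subrr //; apply: le_anti; rewrite ge.
  by congr (_ * _); exact: mE.
have nodes (k : nat) : (k <= N e)%N -> \int[mu]_(t in `[0, node N e k]) g t = Y k - Y 0%N.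
  elim: k => [_|k IH kN]; first by rewrite node0 set_itv1 Rintegral_set1 subrr.
  have := piece (Ordinal kN) (node N e k.+1) (element_nodeR k) => /= ->.
  rewrite IH ?(ltnW kN) // nodeS /slope; field; rewrite gt_eqF ?width_gt0 //.
by move=> /piece ->; rewrite nodes ?(ltnW (ltn_ord i)) // /affine; ring.
Qed.

Lemma hat_exists (Y : nat -> R) : exists f : R -> R,
  [/\ L2 (len e) f, H1 (len e) f &
   forall (i : 'I_(N e)) x, element N e i x -> f x = aff i (Y i) (Y i.+1) x].
Proof.
pose g := step (fun j : 'I_(N e) => slope w (Y j) (Y j.+1)).
pose f x := Y 0%N + \int[mu]_(t in `[0, x]) g t.
have fE (i : 'I_(N e)) x : element N e i x -> f x = aff i (Y i) (Y i.+1) x.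
  by move=> ix; rewrite /f (step_primitive Y ix) addrC subrK.
have fH1 : H1 (len e) f.
  exists g; first exact: step_L2.
  by move=> x _; rewrite /f set_itv1 Rintegral_set1 addr0.
have fc := H1_continuous (ltW (len_gt0 e)) fH1.
exists f; split => //; split.
  exact: subspace_continuous_measurable_fun.
apply: continuous_compact_integrable; first exact: segment_compact.
by move=> x; apply: (@continuousM _ _ (f : subspace _ -> R) f); exact: fc.
Qed.

End EdgeFunctions.

(** * Finite element functions and their nodal values *)

Section Discretization.
Variables (R : realType) (G : network R) (N : edge G -> nat).
Hypothesis N_gt0 : forall e, (0 < N e)%N.
Local Notation mu := (@lebesgue_measure R).

Let ae_mu_filter : Filter (nbhs (almost_everywhere mu)).
Proof. exact: (ae_filter_ringOfSetsType mu). Qed.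

(** Every edge has its own end nodes, as nothing is continuous across vertices; edges are coupled by
    the flux conditions alone. *)
Definition mesh_node : finType := {e : edge G & 'I_(N e).+1}.
Definition mesh_element : finType := {e : edge G & 'I_(N e)}.
Local Notation n := #|{: mesh_node}|.

Definition mesh_elt (e : edge G) (i : 'I_(N e)) : mesh_element := existT (fun e : edge G => 'I_(N e)) e i.

Definition mesh_set (k : mesh_element) : set R := element N (tag k) (tagged k).

Definition node_index (e : edge G) (i : nat) : 'I_n :=
  enum_rank (existT (fun e : edge G => 'I_(N e).+1) e (inord i) : mesh_node).
Definition left_node (k : mesh_element) : 'I_n := node_index (tag k) (tagged k).
Definition right_node (k : mesh_element) : 'I_n := node_index (tag k) (tagged k).+1.

Lemma node_cover j : exists k, j = left_node k \/ j = right_node k.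
Proof.
rewrite -[j]enum_valK; case: (enum_val j) => e i.
have iE : (inord i : 'I_(N e).+1) = i by apply: val_inj; rewrite /= inordK.
case: (ltnP i (N e)) => [lt|ge].
  exists (mesh_elt (Ordinal lt)); left.
  by rewrite /left_node /node_index /= iE.
have iN : i = N e :> nat by apply/eqP; rewrite eqn_leq ge -ltnS ltn_ord.
have lt : ((N e).-1 < N e)%N by rewrite prednK.
exists (mesh_elt (Ordinal lt)); right.
by congr (enum_rank (existT _ _ _)); apply: val_inj; rewrite /= inordK prednK.
Qed.

Definition nodal_values (m : netfun G) : 'rV[R]_n :=
  \row_j let: existT e i := (enum_val j : mesh_node) in m e (node N e i).

Lemma nodal_valuesE (m : netfun G) e i : (i <= N e)%N ->
  nodal_values m 0 (node_index e i) = m e (node N e i).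
Proof. by move=> iN; rewrite mxE enum_rankK /= inordK. Qed.

Definition hat (y : 'rV[R]_n) : netfun G :=
  fun e => projT1 (cid (hat_exists (N_gt0 e) (fun i => y 0 (node_index e i)))).

Lemma hatP y e : [/\ L2 (len e) (hat y e), H1 (len e) (hat y e) &
   forall (i : 'I_(N e)) x, element N e i x -> hat y e x =
     affine (node N e i) (width N e) (y 0 (node_index e i)) (y 0 (node_index e i.+1)) x].
Proof. by rewrite /hat; case: cid. Qed.

Lemma hat_node y e i : (i <= N e)%N -> hat y e (node N e i) = y 0 (node_index e i).
Proof.
have [_ _ hE] := hatP y e; rewrite leq_eqVlt => /orP[/eqP iN|lt].
  have lt : ((N e).-1 < N e)%N by rewrite prednK.
  have -> : i = (Ordinal lt).+1 by rewrite /= prednK.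
  by rewrite (hE (Ordinal lt)) ?nodeS ?affine_right ?width_gt0 // -nodeS; exact: element_nodeR.
by rewrite (hE (Ordinal lt)) ?affine_left //; exact: element_nodeL.
Qed.

Lemma nodal_values_hat y : nodal_values (hat y) = y.
Proof.
apply/rowP => j; have [k [->|->]] := node_cover j.
  by rewrite nodal_valuesE ?hat_node // ltnW // ltn_ord.
by rewrite nodal_valuesE ?hat_node // ltn_ord.
Qed.

Definition flux_mx : 'M[R]_(n, #|vertex G|) := \matrix_(i, j)
  (\sum_(e : edge G | (val e).2 == enum_val j) (i == node_index e (N e))%:R -
   \sum_(e : edge G | (val e).1 == enum_val j) (i == node_index e 0)%:R).

Lemma flux_mxE (m : netfun G) v :
  (nodal_values m *m flux_mx) 0 (enum_rank v) = netflux m v.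
Proof.
rewrite mxE; under eq_bigr do rewrite [X in _ * X]mxE enum_rankK mulrBr !mulr_sumr.
rewrite big_split /= sumrN /netflux.
have pick (e : edge G) (i : nat) : (i <= N e)%N ->
    \sum_j nodal_values m 0 j * (j == node_index e i)%:R = m e (node N e i).
  move=> iN; rewrite (bigD1 (node_index e i)) //= eqxx mulr1 nodal_valuesE // big1 ?addr0 //.
  by move=> j /negbTE ->; rewrite mulr0.
congr (_ + _).
  rewrite exchange_big; apply: eq_bigr => e _.
  by rewrite pick // node_last // mulr1.
rewrite exchange_big /= -sumrN; apply: eq_bigr => e _.
by rewrite pick // node0 mulrN1.
Qed.

(** An idempotent whose fixed row vectors are the nodal values of zero flux, the form in which
    [zero_on_subspace] takes a subspace. *)
Definition flux_proj : 'M[R]_n := proj_mx (kermx flux_mx) (kermx flux_mx)^C%MS.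

Lemma flux_projP (y : 'rV[R]_n) : y *m flux_proj = y <-> y *m flux_mx = 0.
Proof.
have dx0 : (kermx flux_mx :&: (kermx flux_mx)^C = 0)%MS.
  by apply/eqP; rewrite -submx0 capmx_compl.
split=> [<-|y0].
  by apply/sub_kermxP; rewrite proj_mx_sub.
by rewrite proj_mx_id //; apply/sub_kermxP.
Qed.

Lemma flux_proj_idem : flux_proj *m flux_proj = flux_proj.
Proof.
have dx0 : (kermx flux_mx :&: (kermx flux_mx)^C = 0)%MS.
  by apply/eqP; rewrite -submx0 capmx_compl.
by rewrite proj_mx_id // -[X in (X <= _)%MS]mul1mx; exact: proj_mx_sub.
Qed.

Lemma Vh_nodal_values m : Vh N m -> nodal_values m *m flux_proj = nodal_values m.
Proof.
move=> [_ [_ fl]]; apply/flux_projP/rowP => j; rewrite -[j]enum_valK flux_mxE fl.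
by rewrite mxE.
Qed.

Lemma Vh_affine m : Vh N m -> forall e, piecewise_affine N e (m e).
Proof. by move=> [[_ mp] [mH1 _]] e; apply: H1_piecewise_affine. Qed.

Lemma Vh_hat y : y *m flux_proj = y -> Vh N (hat y).
Proof.
move=> /flux_projP y0; split; split.
- by move=> e; have [] := hatP y e.
- move=> e i; have [_ _ hE] := hatP y e.
  set al := y 0 (node_index e i); set be := y 0 (node_index e i.+1).
  exists ((al - slope (width N e) al be * node N e i)%:P + slope (width N e) al be *: 'X).
    rewrite (leq_trans (size_polyD _ _)) // geq_max (leq_trans (size_polyC_leq1 _)) //.
    by rewrite (leq_trans (size_scale_leq _ _)) // size_polyX.
  apply: aeW => x ix; rewrite (hE i x ix) -/al -/be !(hornerD, hornerC, hornerZ, hornerX) /affine; ring.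
- by move=> e; have [] := hatP y e.
- by move=> v; rewrite -flux_mxE nodal_values_hat y0 mxE.
Qed.

(** An interval of positive length is not null. *)
Lemma ae_witness (a b : R) (Q : R -> Prop) : a < b ->
  (\forall x \ae mu, `[a, b]%classic x -> Q x) -> exists x, Q x.
Proof.
move=> ab [S [mS S0 sub]]; apply: contrapT => nQ.
have : (mu `[a, b] <= mu S)%E.
  apply: le_measure => //; rewrite ?inE // => x xab; apply: sub => /= /(_ xab) Qx.
  by apply: nQ; exists x.
by rewrite S0 lebesgue_measure_itv /= lte_fin ab -EFinB lee_fin subr_le0 leNgt ab.
Qed.

Lemma Qh_values rho : Qh N rho -> exists r : mesh_element -> R,
  forall k, rho (tag k) = cst (r k) %[ae mu in mesh_set k].
Proof.
move=> [_ rp]; have /choice[r rE] (k : mesh_element) : exists r : R,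
    rho (tag k) = cst r %[ae mu in mesh_set k].
  have [p sp pE] := rp (tag k) (tagged k).
  exists p`_0; apply: (@filterS _ _ ae_mu_filter) pE => x xE /xE ->.
  by rewrite (size1_polyC sp) hornerC coefC.
by exists r.
Qed.

Lemma net_pos_values rho r :
  (forall k : mesh_element, rho (tag k) = cst (r k) %[ae mu in mesh_set k]) ->
  net_pos rho <-> forall k, 0 < r k.
Proof.
move=> rE; split=> [rp [e i]|r0 e].
  have [x ->//] : exists x : R, 0 < r (mesh_elt i).
  apply: (@ae_witness (node N e i) (node N e i.+1)); first exact: node_lt.
  apply: (@filterS2 _ _ ae_mu_filter _ _ _ _ (rp e) (rE (mesh_elt i))) => x x1 x2 ix.
  by have := x2 ix; rewrite /= => <-; apply: x1; exact: (element_sub (N_gt0 e) ix).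
apply: (ae_eint (N_gt0 e)) => i.
by apply: (@filterS _ _ ae_mu_filter) (rE (mesh_elt i)) => x xE ix; have := xE ix; rewrite /= => ->; exact: r0.
Qed.

Definition step_fun (r : mesh_element -> R) : netfun G :=
  fun e => step (fun i : 'I_(N e) => r (mesh_elt i)).

Lemma step_fun_values r (k : mesh_element) :
  step_fun r (tag k) = cst (r k) %[ae mu in mesh_set k].
Proof. by case: k => e i; exact: step_ae. Qed.

Lemma Qh_step_fun r : Qh N (step_fun r).
Proof.
split=> [e|e i]; first exact: step_L2.
exists (r (mesh_elt i))%:P; first exact: size_polyC_leq1.
have := @step_fun_values r (mesh_elt i).
by apply: (@filterS _ _ ae_mu_filter) => x xE /xE ->; rewrite hornerC.
Qed.

Lemma ip_elements (u v : netfun G) (phi psi : mesh_element -> R -> R) :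
  (forall k, continuous (phi k)) -> (forall k, continuous (psi k)) ->
  (forall k, u (tag k) = phi k %[ae mu in mesh_set k]) ->
  (forall k, v (tag k) = psi k %[ae mu in mesh_set k]) ->
  ip u v = \sum_k \int[mu]_(x in mesh_set k) (phi k x * psi k x).
Proof.
move=> phic psic uE vE; rewrite /ip.
rewrite (eq_bigr (fun e => \sum_(i < N e) \int[mu]_(x in element N e i)
   (phi (mesh_elt i) x * psi (mesh_elt i) x))); last first.
  move=> e _; apply: (Rintegral_eint (N_gt0 e)) => [i|i]; first exact: fcontM.
  apply: (@filterS2 _ _ ae_mu_filter _ _ _ _ (uE (mesh_elt i)) (vE (mesh_elt i))).
  by move=> x /= x1 x2 ix; rewrite x1 // x2.
rewrite (sig_big_dep _ _ (fun (e : edge G) (i : 'I_(N e)) => \int[mu]_(x in element N e i)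
   (phi (mesh_elt i) x * psi (mesh_elt i) x))) /=.
by apply: eq_big => [k|[e i] _].
Qed.

End Discretization.

(** * Equivalence of the time step with the nodal system *)

Section TimeStep.
Variables (R : realType) (G : network R) (a b c : edge G -> R) (gamma : R) (N : edge G -> nat).
Hypothesis N_gt0 : forall e, (0 < N e)%N.
Local Notation mu := (@lebesgue_measure R).
Local Notation K := (mesh_element N).
Local Notation n := #|{: mesh_node N}|.

Let ae_mu_filter : Filter (nbhs (almost_everywhere mu)).
Proof. exact: (ae_filter_ringOfSetsType mu). Qed.

Let wd (k : K) := width N (tag k).
Let org (k : K) : R := node N (tag k) (tagged k).
Let aff (y : 'rV[R]_n) (k : K) : R -> R :=
  affine (org k) (wd k) (y 0 (left_node k)) (y 0 (right_node k)).
Let slp (y : 'rV[R]_n) (k : K) : R :=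
  slope (wd k) (y 0 (left_node k)) (y 0 (right_node k)).

Variables (rho0 m0 : netfun G) (r0 : K -> R).
Hypotheses (m0_Vh : Vh N m0)
  (rho0E : forall k, rho0 (tag k) = cst (r0 k) %[ae mu in mesh_set k]).

Let wd_gt0 k : 0 < wd k.
Proof. exact: width_gt0. Qed.

Let cstc (x : R) : continuous (cst x : R -> R).
Proof. by move=> y; exact: cst_continuous. Qed.

Let affc y k : continuous (aff y k).
Proof. exact: affine_continuous. Qed.

Lemma mesh_setE k : mesh_set k = `[org k, org k + wd k]%classic.
Proof. by rewrite /mesh_set elementE. Qed.

Lemma Vh_aff m : Vh N m -> forall k x, mesh_set k x -> m (tag k) x = aff (nodal_values N m) k x.
Proof.
move=> mV [e i] x ix; rewrite (Vh_affine N_gt0 mV ix) /aff /org /wd /=.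
by rewrite !nodal_valuesE //= ltnW // ltn_ord.
Qed.

Lemma Vh_dx m : Vh N m -> forall k, dx m (tag k) = cst (slp (nodal_values N m) k) %[ae mu in mesh_set k].
Proof.
move=> mV [e i]; have := derive_piecewise_affine i (Vh_affine N_gt0 mV (e := e)).
by rewrite /slp /wd /mesh_set /= !nodal_valuesE //= ltnW // ltn_ord.
Qed.

Lemma Rintegral_mesh_cst k (x : R) : \int[mu]_(t in mesh_set k) (cst x t) = x * wd k.
Proof.
rewrite Rintegral_cst; last by rewrite mesh_setE; exact: measurable_itv.
have mE : fine (mu `[org k, org k + wd k]) = wd k.
  by rewrite lebesgue_measure_itv /= lte_fin ltrDl wd_gt0 -EFinB /= addrAC subrr add0r.
by congr (_ * _); rewrite mesh_setE; exact: mE.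
Qed.

Lemma Rintegral_mesh_lin (k : K) (x y : R) (f g : R -> R) : continuous f -> continuous g ->
  \int[mu]_(t in mesh_set k) (x * f t + y * g t) =
  x * \int[mu]_(t in mesh_set k) f t + y * \int[mu]_(t in mesh_set k) g t.
Proof.
move=> fc gc; rewrite mesh_setE RintegralD; last 2 first.
- by apply: continuous_integrable_itv; apply: fcontM => //; exact: cstc.
- by apply: continuous_integrable_itv; apply: fcontM => //; exact: cstc.
- by rewrite !RintegralZl //; exact: continuous_integrable_itv.
exact: measurable_itv.
Qed.

(** Both sides are constant on each element, and the indicator of a single element is an admissible
    test function. *)
Lemma mass_balance tau rho m (r : K -> R) : 0 < tau -> Vh N m ->
  (forall k, rho (tag k) = cst (r k) %[ae mu in mesh_set k]) ->
  (forall q, Qh N q -> ip (bdiff tau rho rho0) q = - ip (dx m) q) <->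
  r = dens (@left_node _ _ N) (@right_node _ _ N) wd r0 tau (nodal_values N m).
Proof.
move=> tau0 mV rE.
have bdE k : bdiff tau rho rho0 (tag k) = cst ((r k - r0 k) / tau) %[ae mu in mesh_set k].
  apply: (@filterS2 _ _ ae_mu_filter _ _ _ _ (rE k) (rho0E k)) => x x1 x2 ix.
  by rewrite /bdiff x1 // x2.
have ipE q t : (forall k, q (tag k) = cst (t k) %[ae mu in mesh_set k]) ->
    ip (bdiff tau rho rho0) q = \sum_k ((r k - r0 k) / tau * t k * wd k) /\
    ip (dx m) q = \sum_k (slp (nodal_values N m) k * t k * wd k).
  move=> qE; split.
    rewrite (ip_elements N_gt0 (fun k => @cstc _) (fun k => @cstc _) bdE qE).
    by apply: eq_bigr => k _; rewrite -Rintegral_mesh_cst.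
  rewrite (ip_elements N_gt0 (fun k => @cstc _) (fun k => @cstc _) (Vh_dx mV) qE).
  by apply: eq_bigr => k _; rewrite -Rintegral_mesh_cst.
have densE k : r k = dens (@left_node _ _ N) (@right_node _ _ N) wd r0 tau (nodal_values N m) k
    <-> (r k - r0 k) / tau = - slp (nodal_values N m) k.
  rewrite /dens /density -/(slp _ k); split=> [->|E].
    by field; rewrite gt_eqF.
  have -> : r k = r0 k + tau * ((r k - r0 k) / tau) by field; rewrite gt_eqF.
  by rewrite E; ring.
split=> [H|rd q /Qh_values[t tE]].
  apply/funext => k; apply/densE.
  pose t k' : R := (k' == k)%:R.
  have [] := ipE _ _ (step_fun_values N_gt0 t); rewrite H; last exact: Qh_step_fun.
  have pick (F : K -> R) : \sum_k' (F k' * t k' * wd k') = F k * wd k.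
    rewrite (bigD1 k) //= /t eqxx mulr1 big1 ?addr0 // => k' /negbTE ->.
    by rewrite mulr0 mul0r.
  rewrite !pick => E1 E2; move: E1; rewrite E2 -mulNr => /esym.
  by apply: mulIf; rewrite gt_eqF.
have [-> ->] := ipE _ _ tE; rewrite -sumrN; apply: eq_bigr => k _.
have /densE -> := congr1 (fun f => f k) rd; ring.
Qed.

Let p0 (k : K) : R := nodal_values N m0 0 (left_node k).
Let p1 (k : K) : R := nodal_values N m0 0 (right_node k).
Let aK (k : K) := a (tag k).
Let bK (k : K) := b (tag k).
Let pK (k : K) : R -> R := pressure c gamma (tag k).
Let cK (k : K) : R -> R -> R -> R -> R := cubic (org k) (wd k).

Definition discrete_form tau r (y z : 'rV[R]_n) : R :=
  form (@left_node _ _ N) (@right_node _ _ N) wd r0 p0 p1 aK bK pK cK tau r y z.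

Definition discrete_density tau (y : 'rV[R]_n) : K -> R :=
  dens (@left_node _ _ N) (@right_node _ _ N) wd r0 tau y.

Lemma Rintegral_mesh_affM k (al be v0 v1 : R) :
  \int[mu]_(x in mesh_set k)
    (affine (org k) (wd k) al be x * affine (org k) (wd k) v0 v1 x) = mass (wd k) al be v0 v1.
Proof. by rewrite mesh_setE integral_affineM. Qed.

(** By the mass balance the time derivative of the density is minus the slope of [m]; its term and
    the explicit transport term are then equal halves, which add up to the full [slope / r ^ 2] term
    of [element_form]. *)
Lemma momentum_balance tau rho m v (r : K -> R) : 0 < tau -> Vh N m -> Vh N v ->
  (forall k, 0 < r0 k) -> (forall k, 0 < r k) ->
  (forall k, rho (tag k) = cst (r k) %[ae mu in mesh_set k]) ->
  r = discrete_density tau (nodal_values N m) ->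
  ip (fun e x => 1 / rho0 e x * bdiff tau m m0 e x
           - m e x / (2 * `|rho e x| ^+ 2) * bdiff tau rho rho0 e x) v
  - (ip (fun e x => `|m e x| ^+ 2 / (2 * `|rho e x| ^+ 2)
             + dpot c gamma rho e x
             - a e / `|rho e x| ^+ 2 * dx m e x) (dx v)
       - ip (fun e x => m e x / (2 * `|rho e x| ^+ 2) * dx m e x) v
       - ip (fun e x => b e * (`|m e x| * m e x / `|rho e x| ^+ 2)) v) =
  discrete_form tau r (nodal_values N m) (nodal_values N v).
Proof.
move=> tau0 mV vV r00 rpos rE rd.
set y := nodal_values N m; set z := nodal_values N v; set y0 := nodal_values N m0.
have vE k : v (tag k) = aff z k %[ae mu in mesh_set k].
  by apply: aeW => x ix; exact: Vh_aff.
have dvE := Vh_dx vV; have dmE := Vh_dx mV.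
pose u1 k x := 1 / r0 k * ((aff y k x - aff y0 k x) / tau) -
  aff y k x / (2 * r k ^+ 2) * ((r k - r0 k) / tau).
pose u2 k x := aff y k x ^+ 2 / (2 * r k ^+ 2) + pK k (r k) - aK k / r k ^+ 2 * slp y k.
pose u3 k x := aff y k x / (2 * r k ^+ 2) * slp y k.
pose u4 k x := bK k * (`|aff y k x| * aff y k x / r k ^+ 2).
have cc (x : R) : continuous (fun _ : R => x) by exact: cstc.
have u1c k : continuous (u1 k).
  apply: fcontB; apply: fcontM => //; apply: fcontM => //; try exact: affc.
  by apply: fcontB; exact: affc.
have u2c k : continuous (u2 k).
  apply: fcontB => //; apply: fcontD => //; apply: fcontM => //; apply: fcontX; exact: affc.
have u3c k : continuous (u3 k).
  by apply: fcontM => //; apply: fcontM => //; exact: affc.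
have u4c k : continuous (u4 k).
  apply: fcontM => //; apply: fcontM => //; apply: fcontM; last exact: affc.
  by apply: fcont_norm; exact: affc.
have norm_r k : `|r k| = r k by rewrite gtr0_norm.
have zc k : continuous (aff z k) := @affc z k.
rewrite (ip_elements N_gt0 u1c zc _ vE); last first.
  move=> k; apply: (@filterS2 _ _ ae_mu_filter _ _ _ _ (rE k) (rho0E k)) => x x1 x2 ix.
  by rewrite /bdiff x1 // x2 // !(Vh_aff _ ix) // /u1 /cst norm_r.
rewrite (ip_elements N_gt0 u2c (fun k => @cstc _) _ dvE); last first.
  move=> k; apply: (@filterS2 _ _ ae_mu_filter _ _ _ _ (rE k) (dmE k)) => x x1 x2 ix.
  rewrite /dpot x1 // x2 // (Vh_aff _ ix) // /u2 /cst norm_r.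
  by rewrite (real_normK (num_real _)).
rewrite (ip_elements N_gt0 u3c zc _ vE); last first.
  move=> k; apply: (@filterS2 _ _ ae_mu_filter _ _ _ _ (rE k) (dmE k)) => x x1 x2 ix.
  by rewrite x1 // x2 // (Vh_aff _ ix) // /u3 /cst norm_r.
rewrite (ip_elements N_gt0 u4c zc _ vE); last first.
  move=> k; apply: (@filterS _ _ ae_mu_filter) (rE k) => x x1 ix.
  by rewrite x1 // (Vh_aff _ ix) // /u4 /cst norm_r.
rewrite -!sumrB; apply: eq_bigr => k _.
have mzc : continuous (fun x => aff y k x * aff z k x) by apply: fcontM; exact: affc.
have mmc : continuous (fun x => aff y k x * aff y k x) by apply: fcontM; exact: affc.
have dzc : continuous (fun x => affine (org k) (wd k) (y 0 (left_node k) - p0 k)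
    (y 0 (right_node k) - p1 k) x * aff z k x).
  by apply: fcontM; [exact: affine_continuous|exact: affc].
have -> : \int[mu]_(x in mesh_set k) (u1 k x * aff z k x) =
   (r0 k * tau)^-1 * mass (wd k) (y 0 (left_node k) - p0 k) (y 0 (right_node k) - p1 k)
       (z 0 (left_node k)) (z 0 (right_node k)) +
   (- ((r k - r0 k) / (tau * (2 * r k ^+ 2)))) * mass (wd k) (y 0 (left_node k))
     (y 0 (right_node k)) (z 0 (left_node k)) (z 0 (right_node k)).
  rewrite -!Rintegral_mesh_affM -Rintegral_mesh_lin //.
  apply: eq_Rintegral => x _; rewrite /u1 /aff -affineB /p0 /p1 -/y0; field.
  by rewrite !gt_eqF.
have -> : \int[mu]_(x in mesh_set k) (u2 k x * cst (slp z k) x) =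
   (slp z k / (2 * r k ^+ 2)) * mass (wd k) (y 0 (left_node k))
     (y 0 (right_node k)) (y 0 (left_node k)) (y 0 (right_node k)) +
   ((pK k (r k) - aK k / r k ^+ 2 * slp y k) * slp z k) * wd k.
  rewrite -[X in _ + _ * X]mul1r -Rintegral_mesh_cst -Rintegral_mesh_affM -Rintegral_mesh_lin //.
  apply: eq_Rintegral => x _; rewrite /u2 /cst /aff; field.
  by rewrite !gt_eqF.
have -> : \int[mu]_(x in mesh_set k) (u3 k x * aff z k x) =
   (slp y k / (2 * r k ^+ 2)) * mass (wd k) (y 0 (left_node k))
     (y 0 (right_node k)) (z 0 (left_node k)) (z 0 (right_node k)).
  rewrite -[RHS]addr0 -[X in _ + X](mul0r (\int[mu]_(x in mesh_set k) cst 0 x)).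
  rewrite -Rintegral_mesh_affM -Rintegral_mesh_lin //.
  apply: eq_Rintegral => x _; rewrite /u3 /aff; field.
  by rewrite !gt_eqF.
have -> : \int[mu]_(x in mesh_set k) (u4 k x * aff z k x) =
   (bK k / r k ^+ 2) * cK k (y 0 (left_node k)) (y 0 (right_node k))
      (z 0 (left_node k)) (z 0 (right_node k)).
  rewrite -[RHS]addr0 -[X in _ + X](mul0r (\int[mu]_(x in mesh_set k) cst 0 x)).
  rewrite /cK /cubic -mesh_setE -Rintegral_mesh_lin //.
    apply: eq_Rintegral => x _; rewrite /u4 /aff; field.
    by rewrite !gt_eqF.
  by apply: fcontM; [apply: fcontM; [apply: fcont_norm|]|]; exact: affine_continuous.
have rk : r k - r0 k = - (tau * slp y k).
  by rewrite rd /discrete_density /dens /density -/(slp y k); ring.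
rewrite rk /element_form -/(slp y k) -/(slp z k); field.
by rewrite !gt_eqF.
Qed.

End TimeStep.

Section Wellposedness.
Variables (R : realType) (G : network R) (a b c : edge G -> R) (gamma : R) (N : edge G -> nat).
Hypothesis N_gt0 : forall e, (0 < N e)%N.
Variables (rho0 m0 : netfun G) (r0 : mesh_element N -> R).
Hypothesis m0_Vh : Vh N m0.
Hypothesis rho0E : forall k,
  (\forall x \ae @lebesgue_measure R, mesh_set k x -> rho0 (tag k) x = cst (r0 k) x).
Hypothesis r0_gt0 : forall k, 0 < r0 k.

Definition discrete_solution (tau : R) (y : 'rV[R]_(#|{: mesh_node N}|)) : Prop :=
  solution (@left_node _ _ N) (@right_node _ _ N) (fun k => width N (tag k)) r0
    (fun k => nodal_values N m0 0 (left_node k)) (fun k => nodal_values N m0 0 (right_node k))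
    (fun k => a (tag k)) (fun k => b (tag k)) (fun k => pressure c gamma (tag k))
    (fun k => cubic (node N (tag k) (tagged k)) (width N (tag k))) (flux_proj N) tau y.

Lemma discrete_solution_time_step tau y : 0 < tau -> discrete_solution tau y ->
  let rho := step_fun (discrete_density r0 tau y) in
  time_step N a b c gamma tau rho0 m0 rho (hat N_gt0 y) /\ net_pos rho.
Proof.
move=> tau0 [yP dpos y0] rho.
have rhoE := step_fun_values N_gt0 (discrete_density r0 tau y).
have hV := Vh_hat N_gt0 yP.
have yE : nodal_values N (hat N_gt0 y) = y := nodal_values_hat N_gt0 y.
have rE : discrete_density r0 tau y = discrete_density r0 tau (nodal_values N (hat N_gt0 y)).
  by rewrite yE.
split; last by apply/(net_pos_values N_gt0 rhoE).
split => //; first exact: Qh_step_fun.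
  exact/(mass_balance N_gt0 rho0E tau0 hV rhoE).
move=> v vV; apply/eqP; rewrite -subr_eq0; apply/eqP.
rewrite (momentum_balance a b c gamma N_gt0 m0_Vh rho0E tau0 hV vV r0_gt0 dpos rhoE rE) yE.
by apply: y0; exact: Vh_nodal_values.
Qed.

(** Every nodal vector of zero flux is that of its [hat], so testing with [Vh] reaches all test
    vectors of the nodal system. *)
Lemma time_step_discrete_solution tau rho m : 0 < tau ->
  time_step N a b c gamma tau rho0 m0 rho m -> net_pos rho ->
  discrete_solution tau (nodal_values N m) /\
  (forall k, \forall x \ae @lebesgue_measure R, mesh_set k x ->
     rho (tag k) x = cst (discrete_density r0 tau (nodal_values N m) k) x).
Proof.
move=> tau0 [rhoQ mV eq1 eq2] rpos.
have [r rE] := Qh_values rhoQ.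
have /(net_pos_values N_gt0 rE) r_gt0 := rpos.
have /(mass_balance N_gt0 rho0E tau0 mV rE) rd := eq1.
have rd' : r = discrete_density r0 tau (nodal_values N m) by [].
clear rd; subst r; split => //; split => //; first exact: Vh_nodal_values.
move=> z zP; have hV := Vh_hat N_gt0 zP.
have := momentum_balance a b c gamma N_gt0 m0_Vh rho0E tau0 mV hV r0_gt0 r_gt0 rE erefl.
by rewrite nodal_values_hat eq2 // subrr => /esym.
Qed.

End Wellposedness.

Theorem lemma5p3 (R : realType) (G : network R)
    (a b c : edge G -> R) (gamma : R) (N : edge G -> nat)
    (a_ge0 : forall e, 0 <= a e) (b_ge0 : forall e, 0 <= b e)
    (c_gt0 : forall e, 0 < c e) (gamma_gt1 : 1 < gamma)
    (N_gt0 : forall e, (0 < N e)%N)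
    (rho0 m0 : netfun G)
    (rho0_Qh : Qh N rho0) (m0_Vh : Vh N m0) (rho0_gt0 : net_pos rho0) :
  (exists2 tau0 : R, 0 < tau0 & forall tau : R, 0 < tau <= tau0 ->
     exists rho m : netfun G,
       [/\ time_step N a b c gamma tau rho0 m0 rho m, net_pos rho &
        forall rho' m' : netfun G,
          time_step N a b c gamma tau rho0 m0 rho' m' -> net_pos rho' ->
          net_eq rho' rho /\ net_eq m' m]) /\
  ((exists2 a_ : R, 0 < a_ & forall e, a_ <= a e) ->
   forall tau : R, 0 < tau ->
     exists rho m : netfun G,
       time_step N a b c gamma tau rho0 m0 rho m /\ net_pos rho).
Proof.
have [r0 rho0E] := Qh_values rho0_Qh.
have /(net_pos_values N_gt0 rho0E) r0_gt0 := rho0_gt0.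
have w_gt0 (k : mesh_element N) : 0 < width N (tag k) by exact: width_gt0.
have pr_ge0 (k : mesh_element N) := pressure_ge0 (c_gt0 (tag k)) gamma_gt1.
have pr_mono (k : mesh_element N) := pressure_mono (c_gt0 (tag k)) gamma_gt1.
have pr_cont (k : mesh_element N) := @pressure_continuous R G c gamma (tag k).
have cub_lin (k : mesh_element N) := @cubic_linear R (node N (tag k) (tagged k)) (width N (tag k)).
have cub_ge0 (k : mesh_element N) := @cubic_ge0 R (node N (tag k) (tagged k)) (width N (tag k)).
have cub_0 (k : mesh_element N) := @cubic0 R (node N (tag k) (tagged k)) (width N (tag k)).
have cub_lip (k : mesh_element N) := @cubic_lip R (node N (tag k) (tagged k)) _ (w_gt0 k).
split.
  have [tau0 tau0_gt0 H] := small_step_solution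
    (fun k => nodal_values N m0 0 (left_node k)) (fun k => nodal_values N m0 0 (right_node k))
    (@node_cover R G N N_gt0) w_gt0 r0_gt0 (fun k => a_ge0 (tag k)) (fun k => b_ge0 (tag k))
    pr_ge0 pr_mono pr_cont cub_lin cub_ge0 cub_0 cub_lip (flux_proj_idem N).
  exists tau0 => // tau tau_bd; have /andP[tau_gt0 _] := tau_bd.
  have [y ysol yuniq] := H tau tau_bd.
  have [ts rpos] := discrete_solution_time_step N_gt0 m0_Vh rho0E r0_gt0 tau_gt0 ysol.
  exists (step_fun (discrete_density r0 tau y)), (hat N_gt0 y); split => // rho' m' ts' rpos'.
  have [sol' rho'E] := time_step_discrete_solution N_gt0 m0_Vh rho0E r0_gt0 tau_gt0 ts' rpos'.
  (* Equal nodal momenta give equal densities, by the mass balance. *)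
  have yE := yuniq _ sol'; rewrite yE in rho'E.
  have ae_mu_filter : Filter (nbhs (almost_everywhere (@lebesgue_measure R))).
    exact: (ae_filter_ringOfSetsType (@lebesgue_measure R)).
  split => e; apply: (ae_eint (N_gt0 e)) => i.
    apply: (@filterS2 _ _ ae_mu_filter _ _ _ _ (rho'E (mesh_elt i))
      (step_fun_values N_gt0 (discrete_density r0 tau y) (mesh_elt i))).
    by move=> x x1 x2 ix; have := x1 ix; have := x2 ix; rewrite /= => -> ->.
  apply: aeW => x ix; have [_ m'V _ _] := ts'.
  have [_ _ hE] := hatP N_gt0 y e; rewrite (hE i x ix) (Vh_affine N_gt0 m'V ix).
  by rewrite -yE !nodal_valuesE // ltnW // ltn_ord.
move=> [a_ a_gt0 aP] tau tau_gt0.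
have [y ysol] := damped_solution
  (fun k => nodal_values N m0 0 (left_node k)) (fun k => nodal_values N m0 0 (right_node k))
  (@node_cover R G N N_gt0) w_gt0 r0_gt0 (fun k => a_ge0 (tag k)) (fun k => b_ge0 (tag k))
  pr_ge0 pr_mono pr_cont cub_lin cub_ge0 cub_lip (flux_proj_idem N)
  (fun k => lt_le_trans a_gt0 (aP (tag k))) tau_gt0.
have [ts rpos] := discrete_solution_time_step N_gt0 m0_Vh rho0E r0_gt0 tau_gt0 ysol.
by exists (step_fun (discrete_density r0 tau y)), (hat N_gt0 y).
Qed.
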